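(* There is an algorithm (the meta-algorithm described in the context) which, for any functional graph $\mathcal{G}$ with $n$ vertices, uses at most $O(k_*\cdot n)$ bit comparisons and linear memory space to build canonical labels of the connected components of $\mathcal{G}$ of total size $2n$ bits, which can be represented in a trie of size $O(n)$. Here $k_*$ is the largest number of vertices in a connected component of $\mathcal{G}$.
   Context: For a function $f$ from a finite set $V$ to itself, its functional graph is the directed graph on $V$ with an edge $u\to v$ if and only if $f(u)=v$ (loops allowed). Connected components are those of the underlying undirected graph; each contains exactly one directed cycle (possibly a loop), and each cycle vertex is the root of a tree consisting of the vertices whose forward paths first meet the cycle there. Canonical labels: bit strings assigned to components so that two components receive the same string if and only if they are isomorphic. A trie (prefix tree) is the rooted tree whose nodes are the prefixes of the stored strings; each node carries a counter of the number of stored strings terminating there; its size is the number of its nodes. Meta-algorithm. Phase 1: identify the connected components with their cycles and trees. Phase 2: for each component, represent the tree rooted at each cycle vertex in left-child–right-sibling binary form (left child of a vertex is its first child, right child is its next sibling), extend it to a full binary tree by adding a leaf wherever a child is missing, except that no right child is added at the root; give bit $1$ to every original vertex and bit $0$ to every added leaf. Recursively, the label of an original vertex is $1$ followed by the concatenation, sorted from largest to smallest, of the labels of its children together with the terminating label $0$; the label of the root (with the label $0$ for an added leaf) is the label of the tree. Concatenate the labels of the trees in the order of the cycle, and take the circular rotation, among those that start at the label of some cycle vertex, that has the largest value as a binary number. Phase 3: insert the labels of all components into a trie with counters. ''Linear'' memory means linear in the size of the input, an adjacency list with $n$ arcs. *)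

(* Defs.v *)
From mathcomp Require Import all_boot.
Set Implicit Arguments.
Unset Strict Implicit.
Unset Printing Implicit Defensive.

(* The functional graph of [f : 'I_n -> 'I_n] has vertex set ['I_n]. *)
Definition arc n (f : 'I_n -> 'I_n) : rel 'I_n := fun u v => f u == v.

Definition component n (f : 'I_n -> 'I_n) (v : 'I_n) : {set 'I_n} :=
  [set u | connect (fun x y => arc f x y || arc f y x) v u].

Definition components n (f : 'I_n -> 'I_n) : {set {set 'I_n}} :=
  [set component f v | v : 'I_n].

Definition max_component_size n (f : 'I_n -> 'I_n) : nat :=
  \max_(A in components f) #|A|.

(* [v] is reachable from its own image, i.e. it lies on the directed cycle
   (possibly a loop) of its component. *)
Definition on_cycle n (f : 'I_n -> 'I_n) : pred 'I_n :=
  fun v => fconnect f (f v) v.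

(* The first cycle vertex on the forward path [v, f v, f (f v), ...]. *)
Definition tree_root n (f : 'I_n -> 'I_n) (v : 'I_n) : 'I_n :=
  nth v (orbit f v) (find (on_cycle f) (orbit f v)).

(* Children in the trees hanging from the cycles: the predecessor of a cycle
   vertex on the cycle is not one of its children. *)
Definition children n (f : 'I_n -> 'I_n) (v : 'I_n) : seq 'I_n :=
  [seq u <- enum 'I_n | (f u == v) && ~~ on_cycle f u].

Definition isomorphic n (f : 'I_n -> 'I_n) (A : {set 'I_n})
    m (g : 'I_m -> 'I_m) (B : {set 'I_m}) : Prop :=
  exists h : 'I_n -> 'I_m,
    [/\ {in A &, injective h}, h @: A = B
      & {in A &, forall u v, arc g (h u) (h v) = arc f u v}].

Definition bits := seq bool.

(* Most significant bit first. *)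
Definition binary_value (s : bits) : nat :=
  foldl (fun x (b : bool) => x.*2 + b) 0 s.

Definition bits_ge : rel bits := fun s t => binary_value t <= binary_value s.

(* In the completed left-child right-sibling binary tree every original vertex
   carries 1 and every added leaf 0.  Reading it in prefix order, with siblings
   sorted, the vertex [v] is followed by its children and then by the leaf that
   ends their list of siblings (or replaces the first child): this is the
   terminating label [:: false].  The first argument bounds the depth. *)
Fixpoint label_upto (d : nat) n (f : 'I_n -> 'I_n) (v : 'I_n) : bits :=
  if d is d'.+1 then
    true :: flatten (sort bits_ge
              (rcons [seq label_upto d' f u | u <- children f v] [:: false]))
  else [::].

(* Paths in the trees have at most [n] vertices. *)
Definition tree_label n (f : 'I_n -> 'I_n) (v : 'I_n) : bits := label_upto n f v.

(* The labels of the trees along the cycle, starting at the cycle vertex [r]. *)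
Definition cycle_word n (f : 'I_n -> 'I_n) (r : 'I_n) : bits :=
  flatten [seq tree_label f v | v <- orbit f r].

Definition component_label n (f : 'I_n -> 'I_n) (A : {set 'I_n}) : bits :=
  foldr (fun s t => if bits_ge s t then s else t) [::]
    [seq cycle_word f r | r <- enum A & on_cycle f r].

Definition component_labels n (f : 'I_n -> 'I_n) : seq bits :=
  [seq component_label f A | A <- enum (components f)].

Definition canonical (label : forall n, ('I_n -> 'I_n) -> {set 'I_n} -> bits) :
    Prop :=
  forall n (f : 'I_n -> 'I_n) m (g : 'I_m -> 'I_m) A B,
    A \in components f -> B \in components g ->
    (label n f A = label m g B <-> isomorphic f A g B).

(* The nodes are the prefixes of the stored strings; [trie_counter L p] is
   the counter at the node [p]. *)

Definition trie_nodes (L : seq bits) : seq bits :=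
  undup [seq take i s | s <- L, i <- iota 0 (size s).+1].

Definition trie_counter (L : seq bits) (p : bits) : nat := count_mem p L.

Definition trie_size (L : seq bits) : nat := size (trie_nodes L).

(* Programs are while programs over finitely many word arrays and bit arrays,
   named by natural numbers.  Words are only used as indices and copied, added
   or subtracted: the only test that can influence control, in [If] as in
   [While], compares two bits, and each such comparison is charged one unit.
   On a machine of capacity [M], every array has [M] cells and every word is
   smaller than [M]; execution is stuck when it exceeds this capacity. *)

Inductive exp :=
| Const of nat
| Get of nat & exp
| Add of exp & exp
| Sub of exp & exp.

Inductive bexp :=
| Bit of bool
| GetBit of nat & exp.

Inductive cmd :=
| Skip
| Put of nat & exp & exp
| PutBit of nat & exp & bexp
| Seq of cmd & cmd
| If of bexp & bexp & cmd & cmd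
| While of bexp & bexp & cmd.

Record store := MkStore { word : nat -> nat -> nat; bit : nat -> nat -> bool }.

Definition update T (m : nat -> nat -> T) a i x : nat -> nat -> T :=
  fun b j => if (b == a) && (j == i) then x else m b j.

Definition set_word s a i x := MkStore (update (word s) a i x) (bit s).
Definition set_bit s a i x := MkStore (word s) (update (bit s) a i x).

Definition fit (M x : nat) : option nat := if x < M then Some x else None.

Fixpoint eval (M : nat) (s : store) (e : exp) : option nat :=
  match e with
  | Const k => fit M k
  | Get a e1 => obind (fun i => fit M (word s a i)) (eval M s e1)
  | Add e1 e2 =>
      obind (fun x => obind (fun y => fit M (x + y)) (eval M s e2)) (eval M s e1)
  | Sub e1 e2 =>
      obind (fun x => obind (fun y => fit M (x - y)) (eval M s e2)) (eval M s e1)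
  end.

Definition beval (M : nat) (s : store) (b : bexp) : option bool :=
  match b with
  | Bit x => Some x
  | GetBit a e => omap (bit s a) (eval M s e)
  end.

(* [exec M c s t s']: with capacity [M], the program [c] started in [s]
   terminates in [s'] after exactly [t] bit comparisons.  [If b1 b2 c1 c2] runs
   [c1] when the bits are equal, and [While b1 b2 c] loops while they are. *)
Inductive exec (M : nat) : cmd -> store -> nat -> store -> Prop :=
| ExecSkip s :
    exec M Skip s 0 s
| ExecPut s a e1 e2 i x :
    eval M s e1 = Some i -> eval M s e2 = Some x ->
    exec M (Put a e1 e2) s 0 (set_word s a i x)
| ExecPutBit s a e b i x :
    eval M s e = Some i -> beval M s b = Some x ->
    exec M (PutBit a e b) s 0 (set_bit s a i x)
| ExecSeq c1 c2 s1 s2 s3 t1 t2 :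
    exec M c1 s1 t1 s2 -> exec M c2 s2 t2 s3 ->
    exec M (Seq c1 c2) s1 (t1 + t2) s3
| ExecIf b1 b2 c1 c2 s s' t x1 x2 :
    beval M s b1 = Some x1 -> beval M s b2 = Some x2 ->
    exec M (if x1 == x2 then c1 else c2) s t s' ->
    exec M (If b1 b2 c1 c2) s t.+1 s'
| ExecWhileDone b1 b2 c s x1 x2 :
    beval M s b1 = Some x1 -> beval M s b2 = Some x2 -> x1 != x2 ->
    exec M (While b1 b2 c) s 1 s
| ExecWhileLoop b1 b2 c s1 s2 s3 t1 t2 x :
    beval M s1 b1 = Some x -> beval M s1 b2 = Some x ->
    exec M c s1 t1 s2 -> exec M (While b1 b2 c) s2 t2 s3 ->
    exec M (While b1 b2 c) s1 (t1 + t2).+1 s3.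

(* The arrays occurring in a program: [(true, a)] is the word array [a] and
   [(false, a)] the bit array [a]. *)
Fixpoint exp_arrays (e : exp) : seq (bool * nat) :=
  match e with
  | Const _ => [::]
  | Get a e1 => (true, a) :: exp_arrays e1
  | Add e1 e2 | Sub e1 e2 => exp_arrays e1 ++ exp_arrays e2
  end.

Definition bexp_arrays (b : bexp) : seq (bool * nat) :=
  if b is GetBit a e then (false, a) :: exp_arrays e else [::].

Fixpoint arrays (c : cmd) : seq (bool * nat) :=
  match c with
  | Skip => [::]
  | Put a e1 e2 => (true, a) :: exp_arrays e1 ++ exp_arrays e2
  | PutBit a e b => (false, a) :: exp_arrays e ++ bexp_arrays b
  | Seq c1 c2 => arrays c1 ++ arrays c2
  | If b1 b2 c1 c2 =>
      bexp_arrays b1 ++ bexp_arrays b2 ++ arrays c1 ++ arrays c2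
  | While b1 b2 c1 => bexp_arrays b1 ++ bexp_arrays b2 ++ arrays c1
  end.

(* The number of memory cells of a machine of capacity [M] running [c]. *)
Definition memory (c : cmd) (M : nat) : nat := size (undup (arrays c)) * M.

(* Word arrays. *)
Definition SUCC := 0.       (* input: the arcs *)
Definition ORDER := 1.      (* input: number of vertices, in cell 0 *)
Definition NCOMP := 2.      (* number of components, in cell 0 *)
Definition COMP := 3.       (* component number of each vertex *)
Definition ROOT := 4.       (* tree root of each vertex *)
Definition START := 5.      (* start in [LABEL] of the label of each component *)
Definition LENGTH := 6.     (* length of the label of each component *)
Definition COUNTER := 7.    (* counter of each trie node *)
Definition CHILD (b : bool) := if b then 9 else 8. (* children of trie nodes *)

(* Bit arrays. *)
Definition CYCLE := 0.      (* whether a vertex is on a cycle *)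
Definition LABEL := 1.      (* the bits of the labels *)
Definition HASCHILD (b : bool) := if b then 3 else 2. (* existence of children *)

(* All cells that do not hold the input are initially 0. *)
Definition input n (f : 'I_n -> 'I_n) : store :=
  MkStore
    (fun a i =>
       if a == SUCC then (if insub i is Some v then nat_of_ord (f v) else 0)
       else if (a == ORDER) && (i == 0) then n else 0)
    (fun _ _ => false).

Definition numbering n (f : 'I_n -> 'I_n) (num : {set 'I_n} -> nat) : Prop :=
  {in components f &, injective num} /\
  {in components f, forall A, num A < #|components f|}.

Definition components_identified n (f : 'I_n -> 'I_n) num (s : store) : Prop :=
  word s NCOMP 0 = #|components f| /\
  forall v : 'I_n, [/\ word s COMP v = num (component f v),
                       bit s CYCLE v = on_cycle f v
                     & word s ROOT v = tree_root f v].

Definition labels_built n (f : 'I_n -> 'I_n) num (s : store) : Prop :=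
  {in components f, forall A,
    [seq bit s LABEL i
       | i <- iota (word s START (num A)) (word s LENGTH (num A))]
    = component_label f A}.

(* The nodes of the trie of [L] are numbered from 0, the root being node 0. *)
Definition trie_built (L : seq bits) (s : store) : Prop :=
  exists node : bits -> nat,
    [/\ node [::] = 0, {in trie_nodes L &, injective node}
      & {in trie_nodes L, forall p,
          [/\ node p < trie_size L,
              word s COUNTER (node p) = trie_counter L p
            & forall b,
                bit s (HASCHILD b) (node p) = (rcons p b \in trie_nodes L) /\
                (rcons p b \in trie_nodes L ->
                 word s (CHILD b) (node p) = node (rcons p b))]}].

(* Main.v *)
From mathcomp Require Import all_boot.
From mathcomp Require Import zify.
Require Import Defs.

(** Canonicity.  Every vertex contributes one bit 1 and one bit 0 to the label
of its tree, nested like brackets, so the labels of trees form a prefix code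
([tree_label_cat_inj]) in which a label of length [2 * k] describes a tree with
[k] vertices.  Listing the vertices in the order of their bits 1
([cycle_preorder]) enumerates the component without repetition, and equal words
make two such lists run in parallel: the images of vertices at equal positions
are again at equal positions ([cycle_preorder_arcs]).  Hence the map between
equal positions is an isomorphism.  Conversely an isomorphism preserves cycles,
children and therefore the labels of the trees, and taking the largest rotation
removes the choice of the starting point ([iso_component_label]).

Size.  The label of a component [A] has [2 * #|A|] bits and the components
partition the vertices, so the labels have [2 * n] bits in total; a node of the
trie other than the root can be charged to one of these bits
([trie_size_le]).

The algorithm.  Let [K] be the largest size of a component.
- A walk from each vertex until its first repetition tells whether the vertex
  is on a cycle, a second walk finds its root and its depth.  Each walk has at
  most [K] steps.
- A label is stored as a linked list of tokens: the token [v] opens the vertex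
  [v] and the token [n + v] closes it.  The bit of a token is decided by
  comparing it with [n], so the label is read by following the links, and
  adding a subtree to a list of siblings redirects two links.  This keeps the
  memory linear although the labels of all the subtrees together may have
  quadratic length.
- The vertices are inserted into the sorted lists of their parents by decreasing
  depth, so that a subtree is complete when it is inserted ([runs_level]).
  The search for the place of [v] compares the label of [v] with labels of
  siblings; each comparison costs at most a multiple of the length of the label
  of the sibling, and these lengths add up to at most the length of the label
  of the parent ([runs_search]).  An insertion thus costs [O(K)] comparisons.
- Joining the closing token of each cycle vertex to the next cycle vertex turns
  the tokens of a component into a circular list, whose rotations are compared
  in [O(K)] steps each ([runs_best_rotations]).
- The labels are copied and then inserted into the trie bit by bit.
So every vertex and every component pays [O(K)] bit comparisons; this includes
one test of every vertex for each of the at most [K] depths.  All words stay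
below [2 * n + 3], hence a capacity linear in [n] is enough. *)

Set Implicit Arguments.
Unset Strict Implicit.
Unset Printing Implicit Defensive.

(** * Binary values of bit strings *)

Lemma binary_value_rcons s (b : bool) :
  binary_value (rcons s b) = (binary_value s).*2 + b.
Proof. by rewrite /binary_value foldl_rcons. Qed.

Lemma binary_value_lt s : binary_value s < 2 ^ size s.
Proof.
elim/last_ind: s => [|s b IH] //.
rewrite binary_value_rcons size_rcons expnS; case: b; lia.
Qed.

Lemma binary_value_ge s : 2 ^ size s <= binary_value (true :: s).
Proof.
elim/last_ind: s => [|s b IH] //.
rewrite -rcons_cons binary_value_rcons size_rcons expnS; lia.
Qed.

Lemma binary_value_inj s t :
  size s = size t -> binary_value s = binary_value t -> s = t.
Proof.
elim/last_ind: s t => [|s b IH] t; first by case: t.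
case/lastP: t => [|t c]; first by rewrite size_rcons.
rewrite !size_rcons !binary_value_rcons => -[sz] v.
have bc : b = c by case: b c v => -[]; lia.
rewrite bc; congr rcons; apply: IH => //; lia.
Qed.

(** A leading bit 1 outweighs everything that follows it. *)
Lemma binary_value_size_lt s t :
  size s <= size t -> binary_value s < binary_value (true :: t).
Proof.
move=> le_st; apply: leq_trans (binary_value_lt s) _.
by apply: leq_trans (binary_value_ge t); rewrite leq_exp2l.
Qed.

Lemma binary_value_true_size s t :
  size s < size t -> binary_value (true :: s) < binary_value (true :: t).
Proof. by move=> lt_st; apply: binary_value_size_lt. Qed.

(** The strings without redundant leading zeros.  All the strings that are
sorted inside a label have this form, so sorting them by value leaves no ties
between distinct strings. *)
Definition numeral : pred bits := fun s => (s == [:: false]) || head false s.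

Lemma numeral_inj s t :
  numeral s -> numeral t -> binary_value s = binary_value t -> s = t.
Proof.
have pos u : 0 < binary_value (true :: u).
  by apply: leq_trans (binary_value_ge u); rewrite expn_gt0.
have numeralP u : numeral u -> u = [:: false] \/ exists u', u = true :: u'.
  by case/orP=> [/eqP->|]; [left | case: u => [|[] u] // _; right; exists u].
case/numeralP=> [->|[{}s ->]] /numeralP[->|[{}t ->]] //.
- by move=> e; have := pos t; rewrite -e.
- by move=> e; have := pos s; rewrite e.
move=> e; apply: binary_value_inj => //=.
have [/binary_value_true_size|/binary_value_true_size|->//] :=
  ltngtP (size s) (size t); lia.
Qed.

Lemma bits_ge_total : total bits_ge.
Proof. by move=> s t; apply: leq_total. Qed.

Lemma bits_ge_trans : transitive bits_ge.
Proof. by move=> t s u st tu; apply: leq_trans tu st. Qed.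

(** * Cycles, depths and components *)

Section FunctionalGraph.

Variables (n : nat) (f : 'I_n -> 'I_n).
Implicit Types u v x : 'I_n.

Lemma on_cycleP v : reflect (exists k, iter k.+1 f v = v) (on_cycle f v).
Proof. by apply: (iffP idP) => [/(orbitPcycle 2 3)|/(orbitPcycle 3 2)]. Qed.

Lemma on_cycle_next v : on_cycle f v -> on_cycle f (f v).
Proof.
by case/on_cycleP=> k kv; apply/on_cycleP; exists k; rewrite -iterSr iterS kv.
Qed.

Lemma on_cycle_iter i v : on_cycle f v -> on_cycle f (iter i f v).
Proof. by move=> cv; elim: i => //= i; apply: on_cycle_next. Qed.

Lemma orbit_return v :
  exists2 j, j < order f v & iter (order f v) f v = iter j f v.
Proof.
have /trajectP[j jo e] : iter (order f v) f v \in orbit f v.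
  by rewrite -fconnect_orbit fconnect_iter.
by exists j.
Qed.

Lemma on_cycle_order v : on_cycle f v = (iter (order f v) f v == v).
Proof.
by apply/idP/eqP => [/(orbitPcycle 2 4)//|e]; apply/(orbitPcycle 4 2).
Qed.

Lemma orbit_meets_cycle v : has (on_cycle f) (orbit f v).
Proof.
have [j jo e] := orbit_return v.
apply/hasP; exists (iter j f v); first by apply/trajectP; exists j.
apply/on_cycleP; exists (order f v - j).-1.
by rewrite prednK ?subn_gt0 // -iterD subnK // ltnW.
Qed.

Definition depth v := find (on_cycle f) (orbit f v).

Lemma depth_order v : depth v < order f v.
Proof. by rewrite -(size_orbit f v) -has_find orbit_meets_cycle. Qed.

Lemma nth_orbit i v : i < order f v -> nth v (orbit f v) i = iter i f v.
Proof. by move=> io; rewrite nth_traject. Qed.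

Lemma tree_rootE v : tree_root f v = iter (depth v) f v.
Proof. by rewrite -nth_orbit ?depth_order. Qed.

Lemma tree_root_on_cycle v : on_cycle f (tree_root f v).
Proof. exact: nth_find (orbit_meets_cycle v). Qed.

Lemma before_depth i v : i < depth v -> ~~ on_cycle f (iter i f v).
Proof.
move=> id; have := before_find v id; rewrite nth_orbit; first by move->.
exact: ltn_trans id (depth_order v).
Qed.

Lemma depth_unique i v :
  on_cycle f (iter i f v) -> (forall j, j < i -> ~~ on_cycle f (iter j f v)) ->
  depth v = i.
Proof.
move=> ci lt_i; case: (ltngtP (depth v) i) => // [/lt_i|/before_depth].
  by rewrite -tree_rootE tree_root_on_cycle.
by rewrite ci.
Qed.

Lemma depth_eq0 v : (depth v == 0) = on_cycle f v.
Proof.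
apply/eqP/idP => [d0|cv]; first by have := tree_root_on_cycle v;
  rewrite tree_rootE d0.
exact: depth_unique.
Qed.

Lemma depth_next v : ~~ on_cycle f v -> depth v = (depth (f v)).+1.
Proof.
move=> ncv; apply: depth_unique => [|[|j] jd] //.
  by rewrite iterSr -tree_rootE tree_root_on_cycle.
by rewrite iterSr before_depth.
Qed.

Lemma depth_iter i v : i <= depth v -> depth (iter i f v) = depth v - i.
Proof.
elim: i => [|i IH] id; first by rewrite subn0.
have := IH (ltnW id); rewrite depth_next ?before_depth //=; lia.
Qed.

Lemma order_le_card v : order f v <= n.
Proof. by rewrite -[leqRHS]card_ord; apply: max_card. Qed.

Lemma depth_lt v : depth v < n.
Proof. exact: leq_trans (depth_order v) (order_le_card v). Qed.

Let adj : rel 'I_n := fun x y => arc f x y || arc f y x.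

Let adj_sym : connect_sym adj.
Proof. by apply: sym_connect_sym => x y; rewrite /adj orbC. Qed.

Lemma component_connect u v : (component f u == component f v) =
  connect adj u v.
Proof.
apply/eqP/idP => [/setP/(_ v)|uv]; first by rewrite !inE connect0.
by apply/setP=> x; rewrite !inE (same_connect adj_sym uv).
Qed.

Lemma mem_component u v : (u \in component f v) =
  (component f u == component f v).
Proof. by rewrite inE component_connect adj_sym. Qed.

Lemma component_refl v : v \in component f v.
Proof. by rewrite mem_component. Qed.

Lemma component_next v : component f (f v) = component f v.
Proof.
by apply/eqP; rewrite component_connect connect1 // /adj /arc eqxx orbT.
Qed.

Lemma component_iter i v : component f (iter i f v) = component f v.
Proof. by elim: i => //= i IH; rewrite component_next. Qed.

Lemma component_root v : component f (tree_root f v) = component f v.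
Proof. by rewrite tree_rootE component_iter. Qed.

Lemma componentsP (A : {set 'I_n}) :
  reflect (exists v, A = component f v) (A \in components f).
Proof. by apply: (iffP imsetP) => [[v _]|[v]]; exists v. Qed.

Lemma component_in v : component f v \in components f.
Proof. by apply/componentsP; exists v. Qed.

(** The forward paths of two adjacent vertices meet, and since [f] is a
function two paths that have met never separate; so meeting propagates along
undirected paths. *)
Lemma component_meet u v : component f u = component f v ->
  exists i j, iter i f u = iter j f v.
Proof.
move/eqP; rewrite component_connect => /connectP[p].
elim: p u => [|x p IH] u /=; first by move=> _ ->; exists 0, 0.
case/andP=> /orP[/eqP ux|/eqP xu] px lp; have [i [j e]] := IH x px lp.
  by exists i.+1, j; rewrite iterSr ux.
by exists i, j.+1; rewrite iterS -e -xu -iterSr.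
Qed.

Lemma orbit_back i v : on_cycle f v -> v \in orbit f (iter i f v).
Proof.
case/on_cycleP=> k kv; rewrite -fconnect_orbit.
have e : iter (i * k.+1) f v = v by elim: i => // i IH; rewrite mulSn iterD IH.
by rewrite -{2}e mulnS addnC iterD fconnect_iter.
Qed.

(** A component has a single cycle: the forward paths of [u] and [v] meet, and
from the meeting point the cycle leads back to [v]. *)
Lemma mem_orbit_component u v : on_cycle f u ->
  (v \in orbit f u) = on_cycle f v && (component f v == component f u).
Proof.
move=> cu; apply/idP/andP => [/trajectP[i _ ->]|[cv /eqP uv]].
  by rewrite on_cycle_iter // component_iter.
have [i [j e]] := component_meet (esym uv).
rewrite -fconnect_orbit; apply: connect_trans (fconnect_iter f i u) _.
by rewrite e fconnect_orbit orbit_back.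
Qed.

Lemma orbit_sub_component v : {subset orbit f v <= component f v}.
Proof. by move=> _ /trajectP[i _ ->]; rewrite mem_component component_iter. Qed.

Lemma component_card_le v : #|component f v| <= max_component_size f.
Proof.
by rewrite /max_component_size (bigD1 _ (component_in v)) /= leq_maxl.
Qed.

Lemma order_le_max v : order f v <= max_component_size f.
Proof.
apply: leq_trans (component_card_le v); rewrite -(size_orbit f v).
rewrite -(card_uniqP (orbit_uniq f v)); apply: subset_leq_card.
by apply/subsetP; apply: orbit_sub_component.
Qed.

Lemma depth_lt_max v : depth v < max_component_size f.
Proof. exact: leq_trans (depth_order v) (order_le_max v). Qed.

Lemma max_component_le : max_component_size f <= n.
Proof.
apply/bigmax_leqP => A _; apply: leq_trans (max_card _) _.
by rewrite card_ord.
Qed.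

Lemma max_component_gt0 : 0 < n -> 0 < max_component_size f.
Proof.
move=> n0; apply: leq_trans (order_le_max (Ordinal n0)).
by rewrite order_gt0.
Qed.

End FunctionalGraph.

(** * Labels and preorders of trees *)

Section TreeLabels.

Variables (n : nat) (f : 'I_n -> 'I_n).
Implicit Types u v w : 'I_n.

Lemma mem_children u v : (u \in children f v) = (f u == v) && ~~ on_cycle f u.
Proof. by rewrite mem_filter mem_enum andbT. Qed.

Lemma children_uniq v : uniq (children f v).
Proof. by rewrite filter_uniq ?enum_uniq. Qed.

Lemma depth_child u v : u \in children f v -> depth f u = (depth f v).+1.
Proof. by rewrite mem_children => /andP[/eqP <- /depth_next]. Qed.

Lemma tree_ind (P : 'I_n -> Prop) :
  (forall v, {in children f v, forall u, P u} -> P v) -> forall v, P v.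
Proof.
move=> step v; have [d] := ubnP (n - depth f v).
elim: d v => // d IH v le_d; apply: step => u /depth_child du; apply: IH.
have := depth_lt f v; lia.
Qed.

(** The fuel [n] never runs out: a child is one level deeper than its parent
and depths are smaller than [n].  A function defined by recursion on the fuel
therefore satisfies the recursive equation without fuel. *)
Lemma upto_stable T (F : nat -> 'I_n -> T) (G : 'I_n -> ('I_n -> T) -> T) :
  (forall d v, F d.+1 v = G v (F d)) ->
  (forall v h k, {in children f v, h =1 k} -> G v h = G v k) ->
  forall v, F n v = G v (F n).
Proof.
move=> FS Gext.
have stable d e v : n - depth f v <= d -> n - depth f v <= e -> F d v = F e v.
  elim: d e v => [|d IH] [|e] v; try by have := depth_lt f v; lia.
  move=> dd de; rewrite !FS; apply: Gext => u /depth_child du.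
  by apply: IH; have := depth_lt f v; lia.
move=> v; rewrite -FS; apply: stable; lia.
Qed.

Lemma tree_labelE v :
  tree_label f v = true :: flatten (sort bits_ge
    (rcons [seq tree_label f u | u <- children f v] [:: false])).
Proof.
pose G v h := true :: flatten (sort bits_ge
  (rcons [seq h u | u <- children f v] [:: false])).
apply: (@upto_stable _ (fun d => label_upto d f) G) => // u h k hk.
by rewrite /G; congr (_ :: flatten (sort _ (rcons _ _))); apply/eq_in_map.
Qed.

Lemma tree_label_numeral v : numeral (tree_label f v).
Proof. by rewrite tree_labelE. Qed.

Definition label_ge : rel 'I_n :=
  fun u v => bits_ge (tree_label f u) (tree_label f v).

(** Every sorted order of the children spells the same label, because ties are
between equal strings.  The terminating label has value 0 and comes last. *)
Lemma tree_label_sorted v l :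
    perm_eq l (children f v) -> sorted label_ge l ->
  tree_label f v = true :: flatten [seq tree_label f u | u <- l] ++ [:: false].
Proof.
move=> perm_l sorted_l; rewrite tree_labelE.
set s := rcons _ _; pose t := rcons [seq tree_label f u | u <- l] [:: false].
have num_s : {in s, forall x, numeral x}.
  by move=> x; rewrite mem_rcons inE => /orP[/eqP->//|/mapP[u _ ->]];
    apply: tree_label_numeral.
have -> : sort bits_ge s = sort bits_ge t.
  apply/perm_sort_inP.
  - by move=> x y _ _; apply: bits_ge_total.
  - by move=> x y z _ _ _; apply: bits_ge_trans.
  - move=> x y /num_s nx /num_s ny le; apply: numeral_inj => //.
    by apply/eqP; rewrite eqn_leq andbC.
  - by rewrite perm_rcons perm_sym perm_rcons perm_cons perm_map.
rewrite (sorted_sort bits_ge_trans) /t; first by rewrite flatten_rcons.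
have: sorted bits_ge [seq tree_label f u | u <- l] by rewrite sorted_map.
case: [seq _ | _ <- l] => //= b s' path_s'.
by rewrite rcons_path path_s' /bits_ge.
Qed.

Definition sorted_children v := sort label_ge (children f v).

Lemma perm_sorted_children v : perm_eq (sorted_children v) (children f v).
Proof. by rewrite perm_sort. Qed.

Lemma mem_sorted_children v : sorted_children v =i children f v.
Proof. exact: perm_mem (perm_sorted_children v). Qed.

Lemma tree_label_children v :
  tree_label f v =
  true :: flatten [seq tree_label f u | u <- sorted_children v] ++ [:: false].
Proof.
apply: tree_label_sorted (perm_sorted_children v) _.
by apply: sort_sorted => u w; apply: bits_ge_total.
Qed.

(** The vertices of the tree at [v] in the order of their bits 1 in the label
of [v]. *)
Fixpoint preorder_upto d v : seq 'I_n :=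
  if d is d'.+1 then
    v :: flatten [seq preorder_upto d' u | u <- sorted_children v]
  else [::].

Definition preorder v := preorder_upto n v.

Lemma preorderE v :
  preorder v = v :: flatten [seq preorder u | u <- sorted_children v].
Proof.
pose G v h := v :: flatten [seq h u | u <- sorted_children v] : seq 'I_n.
apply: (@upto_stable _ preorder_upto G) => // u h k hk.
congr (_ :: flatten _); apply/eq_in_map => w.
by rewrite mem_sorted_children => /hk.
Qed.

(** Each step towards the cycle decreases the depth by one, so the path of [u]
can visit [v] only after [depth f u - depth f v] steps. *)
Lemma mem_preorder u v :
  (u \in preorder v) =
  (depth f v <= depth f u) && (iter (depth f u - depth f v) f u == v).
Proof.
elim/tree_ind: v => v IH; rewrite preorderE inE.
have [->|neq_uv] := eqVneq u v; first by rewrite leqnn subnn eqxx.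
apply/flatten_mapP/andP => [[c]|[dvu /eqP uv]].
  rewrite mem_sorted_children => cv; rewrite IH // (depth_child cv).
  move=> /andP[du /eqP uc]; split; first exact: ltnW.
  by rewrite -[depth f u - _]prednK ?subn_gt0 // -subnS iterS uc;
     move: cv; rewrite mem_children => /andP[].
have lt_vu : depth f v < depth f u.
  rewrite ltn_neqAle dvu andbT; apply/eqP => e; case/eqP: neq_uv.
  by rewrite -uv e subnn.
pose i := depth f u - (depth f v).+1.
have iS : depth f u - depth f v = i.+1 by rewrite /i; lia.
have di : depth f (iter i f u) = (depth f v).+1 by rewrite depth_iter /i; lia.
have ic : iter i f u \in children f v.
  by rewrite mem_children -depth_eq0 di andbT -iterS -iS uv.
exists (iter i f u); first by rewrite mem_sorted_children.
by rewrite IH // di lt_vu /=.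
Qed.

(** Blocks from which the index can be recovered are disjoint. *)
Lemma uniq_flatten_map (T U : eqType) (F : T -> seq U) (key : U -> T) s :
    uniq s -> {in s, forall x, uniq (F x)} ->
    {in s, forall x y, y \in F x -> key y = x} ->
  uniq (flatten (map F s)).
Proof.
elim: s => //= x s IH /andP[xs us] uF keyF; rewrite cat_uniq uF ?mem_head //=.
rewrite IH //; last 2 [by move=> y ys; apply: uF; rewrite inE ys orbT].
- rewrite andbT; apply/hasPn => y /flatten_mapP[z zs yz];
  apply: contra xs => yx.
  by rewrite -(keyF x _ y yx) ?mem_head // (keyF z _ y yz) // inE zs orbT.
- by move=> y ys; apply: keyF; rewrite inE ys orbT.
Qed.

Lemma preorder_uniq v : uniq (preorder v).
Proof.
elim/tree_ind: v => v IH; rewrite preorderE /=; apply/andP; split.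
  apply/negP => /flatten_mapP[u]; rewrite mem_sorted_children => uv.
  by rewrite mem_preorder (depth_child uv) ltnn.
pose key u := iter (depth f u - (depth f v).+1) f u.
apply: (@uniq_flatten_map _ _ _ key).
- by rewrite sort_uniq children_uniq.
- by move=> u; rewrite mem_sorted_children => /IH.
move=> u; rewrite mem_sorted_children => uv w.
by rewrite mem_preorder (depth_child uv) => /andP[_ /eqP].
Qed.

Lemma size_flatten_labels l :
    {in l, forall u, size (tree_label f u) = 2 * size (preorder u)} ->
  size (flatten [seq tree_label f u | u <- l]) =
  2 * size (flatten [seq preorder u | u <- l]).
Proof.
elim: l => //= u l IH szl; rewrite !size_cat szl ?mem_head // IH; first lia.
by move=> w wl; rewrite szl // inE wl orbT.
Qed.

Lemma size_tree_label v : size (tree_label f v) = 2 * size (preorder v).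
Proof.
elim/tree_ind: v => v IH; rewrite tree_label_children preorderE /= size_cat.
rewrite size_flatten_labels /=; first lia.
by move=> u; rewrite mem_sorted_children => /IH.
Qed.

Definition cycle_preorder r := flatten [seq preorder v | v <- orbit f r].

Lemma size_cycle_word r : size (cycle_word f r) = 2 * size (cycle_preorder r).
Proof. by apply: size_flatten_labels => u _; apply: size_tree_label. Qed.

Section Rotation.

Variable r : 'I_n.
Hypothesis cyc_r : on_cycle f r.

Lemma cycle_preorder_uniq : uniq (cycle_preorder r).
Proof.
apply: (@uniq_flatten_map _ _ _ (tree_root f)).
- exact: orbit_uniq.
- by move=> v _; apply: preorder_uniq.
move=> v; rewrite mem_orbit_component // => /andP[cv _] u.
rewrite mem_preorder tree_rootE; move: cv; rewrite -depth_eq0 => /eqP->.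
by rewrite subn0 => /eqP.
Qed.

Lemma mem_cycle_preorder : cycle_preorder r =i component f r.
Proof.
move=> u; rewrite mem_component; apply/flatten_mapP/eqP => [[v]|ur].
  rewrite mem_orbit_component // => /andP[_ /eqP <-].
  by rewrite mem_preorder => /andP[_ /eqP <-]; rewrite component_iter.
exists (tree_root f u).
  by rewrite mem_orbit_component // tree_root_on_cycle component_root ur eqxx.
have := tree_root_on_cycle f u; rewrite mem_preorder -depth_eq0 => /eqP->.
by rewrite subn0 tree_rootE eqxx.
Qed.

Lemma size_cycle_preorder : size (cycle_preorder r) = #|component f r|.
Proof.
by rewrite -(card_uniqP cycle_preorder_uniq) (eq_card mem_cycle_preorder).
Qed.

End Rotation.

Lemma tree_label_le v : size (tree_label f v) <= 2 * #|component f v|.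
Proof.
rewrite size_tree_label leq_mul2l /= -(card_uniqP (preorder_uniq v)).
apply: subset_leq_card; apply/subsetP => u; rewrite mem_preorder mem_component.
by case/andP=> _ /eqP <-; rewrite component_iter.
Qed.

End TreeLabels.

(** * Unique reading of labels *)

(** The bit 1 opens a vertex and the bit 0 closes the vertex opened last;
[rest k s] is what remains of [s] after the first [k] open vertices have been
closed. *)
Fixpoint rest k (s : bits) {struct s} : bits :=
  if k is k'.+1 then
    if s is b :: s' then rest (if b then k.+1 else k') s' else [::]
  else s.

Lemma rest_tree_label n (f : 'I_n -> 'I_n) v k s :
  rest k.+1 (tree_label f v ++ s) = rest k.+1 s.
Proof.
elim/(@tree_ind _ f): v k s => v IH k s; rewrite tree_label_children /=.
have: {subset sorted_children f v <= children f v}.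
  by move=> u; rewrite mem_sorted_children.
rewrite -catA; elim: (sorted_children f v) => //= u l IHl sub.
rewrite -catA IH ?sub ?mem_head // IHl // => w wl.
by rewrite sub // inE wl orbT.
Qed.

Section UniqueReading.

Variables (n m : nat) (f : 'I_n -> 'I_n) (g : 'I_m -> 'I_m).

(** The end of a label is where the vertex opened first is closed, so no label
is a proper prefix of another one. *)
Lemma tree_label_cat_inj v w s t :
    tree_label f v ++ s = tree_label g w ++ t ->
  tree_label f v = tree_label g w /\ s = t.
Proof.
move=> e; have st : s = t.
  have := congr1 (fun x => rest 1 (behead x)) e.
  have key k (h : 'I_k -> 'I_k) u x : rest 1 (behead (tree_label h u ++ x)) = x.
    rewrite tree_label_children /= -catA /=.
    have aux l : rest 1 (flatten [seq tree_label h u | u <- l] ++ false :: x) =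
      x.
      by elim: l => [|w' l IH] /=; [case: x | rewrite -catA rest_tree_label].
    by rewrite aux.
  by rewrite !key.
split=> //; have sz : size (tree_label f v) = size (tree_label g w).
  by have := congr1 size e; rewrite st !size_cat; lia.
by move/eqP: e; rewrite eqseq_cat // => /andP[/eqP].
Qed.

Lemma flatten_labels_inj l l' :
    flatten [seq tree_label f v | v <- l] ++ [:: false] =
    flatten [seq tree_label g w | w <- l'] ++ [:: false] ->
  [seq tree_label f v | v <- l] = [seq tree_label g w | w <- l'].
Proof.
elim: l l' => [|v l IH] [|w l'] //=.
- by rewrite tree_labelE.
- by rewrite tree_labelE.
by rewrite -!catA => /tree_label_cat_inj[-> /IH->].
Qed.

Lemma zip_preorders l l' :
    [seq tree_label f v | v <- l] = [seq tree_label g w | w <- l'] ->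
  zip (flatten [seq preorder f v | v <- l])
      (flatten [seq preorder g w | w <- l']) =
  flatten [seq zip (preorder f p.1) (preorder g p.2) | p <- zip l l'].
Proof.
elim: l l' => [|v l IH] [|w l'] //= [vw ll]; rewrite zip_cat ?IH //.
by have := congr1 size vw; rewrite !size_tree_label; lia.
Qed.

Lemma zip_map_eq l l' p :
    [seq tree_label f v | v <- l] = [seq tree_label g w | w <- l'] ->
  p \in zip l l' -> [/\ tree_label f p.1 = tree_label g p.2, p.1 \in l &
    p.2 \in l'].
Proof.
elim: l l' => [|v l IH] [|w l'] //= [vw ll].
rewrite inE => /orP[/eqP->|/IH[]//]; first by rewrite !mem_head.
by move=> e p1 p2; rewrite !inE p1 p2 !orbT.
Qed.

(** Trees with equal labels are enumerated in parallel: when [x] and [y] are at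
equal positions, so are their parents. *)
Lemma preorder_arcs v w x y : tree_label f v = tree_label g w ->
    (x, y) \in zip (preorder f v) (preorder g w) ->
  (x, y) = (v, w) \/ (f x, g y) \in zip (preorder f v) (preorder g w).
Proof.
elim/(@tree_ind _ f): v w => v IH w vw.
have ch : [seq tree_label f u | u <- sorted_children f v] =
          [seq tree_label g u | u <- sorted_children g w].
  by apply: flatten_labels_inj; move: vw; rewrite !tree_label_children => -[].
rewrite !preorderE /= zip_preorders // !inE => /orP[/eqP|]; first by left.
case/flatten_mapP => -[a b] pab xy; right.
have [/= ab] := zip_map_eq ch pab; rewrite !mem_sorted_children => ca cb.
have [[-> ->]|fg] := IH a ca b ab xy.
  move: ca cb; rewrite !mem_children => /andP[/eqP-> _] /andP[/eqP-> _].
  by rewrite eqxx.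
by apply/orP; right; apply/flatten_mapP; exists (a, b).
Qed.

(** The same for whole components, where the root of a tree has the next root
on the cycle as its image. *)
Lemma cycle_preorder_arcs r s x y :
    on_cycle f r -> on_cycle g s -> cycle_word f r = cycle_word g s ->
    (x, y) \in zip (cycle_preorder f r) (cycle_preorder g s) ->
  (f x, g y) \in zip (cycle_preorder f r) (cycle_preorder g s).
Proof.
move=> cr cs rs.
have ls : [seq tree_label f v | v <- orbit f r] =
          [seq tree_label g w | w <- orbit g s].
  by apply: flatten_labels_inj; move: rs; rewrite /cycle_word => ->.
have os : order f r = order g s.
  by have := congr1 size ls; rewrite !size_map !size_orbit.
rewrite zip_preorders // => /flatten_mapP[[a b] pab xy].
have [/= ab _ _] := zip_map_eq ls pab.
apply/flatten_mapP; have [[-> ->]|fg] := preorder_arcs ab xy; last first.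
  by exists (a, b).
exists (f a, g b) => /=; last by rewrite !preorderE /= mem_head.
have [i io [-> ->]] : exists2 i, i < order f r &
  (a, b) = (iter i f r, iter i g s).
  have /(nthP (r, s))[i] := pab; rewrite size_zip !size_orbit os minnn => ig.
  by rewrite nth_zip ?size_orbit // !nth_orbit ?os // => <-; exists i.
apply/(nthP (r, s)); rewrite -!iterS size_zip !size_orbit os minnn -os.
have nthE j : j < order f r -> nth (r, s) (zip (orbit f r) (orbit g s)) j =
                 (iter j f r, iter j g s).
  by move=> jo; rewrite nth_zip ?size_orbit // !nth_orbit // -os.
have [i1|] := ltnP i.+1 (order f r); first by exists i.+1; rewrite ?nthE.
move=> oi; have -> : i.+1 = order f r by lia.
have o0 : 0 < order f r by apply: leq_ltn_trans io.
(* The last root of the cycle is followed by the first one. *)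
exists 0; rewrite ?nthE //=.
by move: cr cs; rewrite !on_cycle_order -os => /eqP-> /eqP->.
Qed.

End UniqueReading.

(** * Labels of components *)

Section ComponentLabels.

Variables (n : nat) (f : 'I_n -> 'I_n).

Lemma size_cycle_word_component r : on_cycle f r ->
  size (cycle_word f r) = 2 * #|component f r|.
Proof. by move=> cr; rewrite size_cycle_word size_cycle_preorder. Qed.

(** The initial value [[::]] of the fold loses every comparison, since it has
value 0 and ties favour the list. *)
Lemma foldr_max (L : seq bits) : L != [::] ->
  let m := foldr (fun s t => if bits_ge s t then s else t) [::] L in
  m \in L /\ {in L, forall s, bits_ge m s}.
Proof.
elim: L => //= s [|t L] IH _ /=.
  by rewrite /bits_ge /= inE eqxx; split=> // x; rewrite inE => /eqP->.
have [] := IH isT; set m := (if bits_ge t _ then _ else _) => mL m_max.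
have ms := bits_ge_total m s; case: ifP ms => [sm _|nsm].
  rewrite mem_head; split=> // x; rewrite inE => /orP[/eqP->|/m_max mx].
    exact: leqnn.
  exact: bits_ge_trans sm mx.
rewrite orbF inE mL orbT => ms; split=> // x.
by rewrite inE => /orP[/eqP->//|/m_max].
Qed.

Lemma component_labelP v :
  exists r, [/\ on_cycle f r, component f r = component f v,
                component_label f (component f v) = cycle_word f r
    & forall s, on_cycle f s -> component f s = component f v ->
        bits_ge (cycle_word f r) (cycle_word f s)].
Proof.
pose L := [seq cycle_word f r | r <- enum (component f v) & on_cycle f r].
have inL r : on_cycle f r -> component f r = component f v ->
  cycle_word f r \in L.
  by move=> cr rv; apply: map_f; rewrite mem_filter cr mem_enum mem_component
    rv /=.
have := inL _ (tree_root_on_cycle f v) (component_root f v).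
case: (eqVneq L [::]) => [->//|/foldr_max[mL m_max] _].
have /mapP[r] := mL; rewrite mem_filter mem_enum mem_component.
case/andP=> cr /eqP rv m_r; exists r; split=> // s cs sv.
by rewrite -m_r; apply: m_max; apply: inL.
Qed.

(** All the rotations have the same length, so a word that is largest in value
is unique. *)
Lemma component_label_unique r : on_cycle f r ->
    (forall s, on_cycle f s -> component f s = component f r ->
      bits_ge (cycle_word f r) (cycle_word f s)) ->
  component_label f (component f r) = cycle_word f r.
Proof.
move=> cr r_max; have [s [cs sr -> s_max]] := component_labelP r.
apply: binary_value_inj; first by rewrite !size_cycle_word_component // sr.
have := r_max s cs sr; have := s_max r cr erefl; rewrite /bits_ge; lia.
Qed.

Lemma size_component_label A : A \in components f ->
  size (component_label f A) = 2 * #|A|.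
Proof.
case/componentsP=> v ->; have [r [cr <- -> _]] := component_labelP v.
exact: size_cycle_word_component.
Qed.

Lemma components_partition : partition (components f) [set: 'I_n].
Proof.
apply/and3P; split.
- apply/eqP/setP => v; rewrite inE; apply/bigcupP.
  by exists (component f v); rewrite ?component_in ?component_refl.
- apply/trivIsetP => _ _ /componentsP[u ->] /componentsP[v ->] uv.
  rewrite -setI_eq0; apply: contraNT uv => /set0Pn[x].
  by rewrite in_setI !mem_component => /andP[/eqP-> ].
- by apply/negP => /componentsP[v /setP/(_ v)]; rewrite component_refl inE.
Qed.

Lemma sum_component_cards : \sum_(A in components f) #|A| = n.
Proof. by rewrite -(card_partition components_partition) cardsT card_ord. Qed.

Lemma sum_component_labels :
  \sum_(A in components f) size (component_label f A) = 2 * n.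
Proof.
rewrite -[in RHS]sum_component_cards big_distrr /=.
by apply: eq_bigr => A; apply: size_component_label.
Qed.

Section ComponentList.

Variable cs : seq {set 'I_n}.
Hypotheses (ucs : uniq cs) (csE : cs =i components f).

Lemma perm_component_list : perm_eq cs (enum (components f)).
Proof.
by apply: uniq_perm; rewrite ?enum_uniq // => A; rewrite mem_enum csE.
Qed.

Lemma size_component_list : size cs = #|components f|.
Proof. by rewrite (perm_size perm_component_list) -cardE. Qed.

Lemma size_component_list_le : size cs <= n.
Proof.
rewrite size_component_list; apply: leq_trans (leq_imset_card _ _) _.
by rewrite card_ord.
Qed.

End ComponentList.

End ComponentLabels.

(** * Labels classify components *)

Section LabelToIsomorphism.

Variables (n m : nat) (f : 'I_n -> 'I_n) (g : 'I_m -> 'I_m).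
Variables (r : 'I_n) (s : 'I_m).
Hypotheses (cyc_r : on_cycle f r) (cyc_s : on_cycle g s).
Hypothesis rs : cycle_word f r = cycle_word g s.

(** The isomorphism sends a vertex to the vertex at the same position of the
other preorder. *)
Lemma cycle_word_isomorphic : isomorphic f (component f r) g (component g s).
Proof.
pose P := cycle_preorder f r; pose Q := cycle_preorder g s.
have uP : uniq P := cycle_preorder_uniq cyc_r.
have uQ : uniq Q := cycle_preorder_uniq cyc_s.
have PA : P =i component f r := mem_cycle_preorder cyc_r.
have QB : Q =i component g s := mem_cycle_preorder cyc_s.
have sPQ : size P = size Q.
  by rewrite /P /Q; have := congr1 size rs; rewrite !size_cycle_word; lia.
pose h x := nth s Q (index x P).
have hP x : x \in P -> (x, h x) \in zip P Q.
  move=> xP; apply/(nthP (r, s)); exists (index x P).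
    by rewrite size_zip -sPQ minnn index_mem.
  by rewrite nth_zip // nth_index.
have zipP a b : (a, b) \in zip P Q -> b = h a.
  case/(nthP (r, s)) => i; rewrite size_zip -sPQ minnn => iP.
  by rewrite nth_zip // => -[<- <-]; rewrite /h index_uniq.
have h_inj : {in P &, injective h}.
  move=> x y xP yP /eqP; rewrite /h nth_uniq -?sPQ ?index_mem // => /eqP e.
  by rewrite -(nth_index r xP) e nth_index.
have hf x : x \in P -> g (h x) = h (f x).
  by move/hP => xP; apply: zipP; apply: cycle_preorder_arcs.
have fP x : x \in P -> f x \in P.
  by rewrite !PA !mem_component component_next.
exists h; split=> [x y||x y]; rewrite -?PA.
- exact: h_inj.
- apply/setP=> y; rewrite -QB; apply/imsetP/idP => [[x]|yQ].
    by rewrite -PA => xP ->; rewrite mem_nth // -sPQ index_mem.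
  have iQ : index y Q < size P by rewrite sPQ index_mem.
  exists (nth r P (index y Q)); first by rewrite -PA mem_nth.
  by rewrite /h index_uniq // nth_index.
- move=> xP yP; rewrite /arc hf //.
  apply/eqP/eqP => [|->//]; exact: h_inj (fP _ xP) yP.
Qed.

End LabelToIsomorphism.

Section IsomorphismToLabel.

Variables (n m : nat) (f : 'I_n -> 'I_n) (g : 'I_m -> 'I_m).
Variables (A : {set 'I_n}) (B : {set 'I_m}) (h : 'I_n -> 'I_m).
Hypotheses (compA : A \in components f) (compB : B \in components g).
Hypotheses (h_inj : {in A &, injective h}) (hAB : h @: A = B).
Hypothesis h_arc : {in A &, forall u v, arc g (h u) (h v) = arc f u v}.

Lemma iso_stable x : x \in A -> f x \in A.
Proof.
by case/componentsP: compA => a ->; rewrite !mem_component component_next.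
Qed.

Lemma iso_next x : x \in A -> g (h x) = h (f x).
Proof.
move=> xA; apply/eqP; rewrite -[_ == _]/(arc g (h x) (h (f x))).
by rewrite h_arc ?iso_stable // /arc eqxx.
Qed.

Lemma iso_iter i x : x \in A -> iter i f x \in A /\ iter i g (h x) =
  h (iter i f x).
Proof.
move=> xA; elim: i => //= i [iA ->].
by rewrite iso_stable // iso_next.
Qed.

Lemma iso_on_cycle x : x \in A -> on_cycle g (h x) = on_cycle f x.
Proof.
move=> xA; apply/on_cycleP/on_cycleP => -[k kx]; exists k.
  have [iA e] := iso_iter k.+1 xA; apply: h_inj => //.
  by rewrite -e.
by have [iA ->] := iso_iter k.+1 xA; rewrite kx.
Qed.

Lemma iso_children x : x \in A ->
  perm_eq (children g (h x)) [seq h u | u <- children f x].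
Proof.
move=> xA.
have chA u : f u = x -> u \in A.
  case/componentsP: compA xA => a ->; rewrite !mem_component => /eqP <- <-.
  by rewrite component_next.
apply: uniq_perm; first exact: children_uniq.
  rewrite map_inj_in_uniq ?children_uniq // => u v.
  rewrite !mem_children => /andP[/eqP/chA uA _] /andP[/eqP/chA vA _];
    exact: h_inj.
move=> y; rewrite mem_children; apply/andP/mapP => [[/eqP yx ncy]|[u]].
  have: y \in B.
    have: h x \in B by rewrite -hAB imset_f.
    by case/componentsP: compB => b ->;
      rewrite !mem_component -yx component_next.
  rewrite -hAB => /imsetP[u uA y_u]; exists u => //; rewrite mem_children.
  rewrite -iso_on_cycle // -y_u ncy andbT; apply/eqP; apply: h_inj => //.
    exact: iso_stable.
  by rewrite -iso_next // -y_u.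
rewrite mem_children => /andP[/eqP ux ncu] ->; have uA := chA u ux.
by rewrite iso_next // ux iso_on_cycle.
Qed.

Lemma iso_tree_label x : x \in A -> tree_label g (h x) = tree_label f x.
Proof.
elim/(@tree_ind _ f): x => x IH xA.
rewrite (tree_label_sorted (perm_sorted_children g (h x))); last first.
  by apply: sort_sorted => u v; apply: bits_ge_total.
suff -> : [seq tree_label g u | u <- sorted_children g (h x)] =
          [seq tree_label f u | u <- sorted_children f x].
  by rewrite -tree_label_children.
have map_sort k (e : 'I_k -> 'I_k) v :
    [seq tree_label e u | u <- sorted_children e v] =
    sort bits_ge [seq tree_label e u | u <- children e v].
  by rewrite sort_map.
rewrite !map_sort; apply/perm_sort_inP.
- by move=> s t _ _; apply: bits_ge_total.
- by move=> s t u _ _ _; apply: bits_ge_trans.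
- move=> _ _ /mapP[u _ ->] /mapP[v _ ->] uv.
  by apply: numeral_inj; rewrite ?tree_label_numeral //; apply/eqP;
    rewrite eqn_leq andbC.
apply: perm_trans (perm_map _ (iso_children xA)) _.
rewrite -map_comp (eq_in_map _ (tree_label f) _).1 // => u ux /=.
apply: IH => //; move: ux; rewrite mem_children => /andP[/eqP ux _].
case/componentsP: compA xA => a ->; rewrite !mem_component => /eqP <-.
by rewrite -ux component_next.
Qed.

Lemma iso_cycle_word x : x \in A -> on_cycle f x ->
  cycle_word g (h x) = cycle_word f x.
Proof.
move=> xA cx; congr flatten.
have ord : order g (h x) = order f x.
  have sub i : i < order f x -> iter i f x \in orbit f x by move=> io;
    apply/trajectP; exists i.
  have fA : {in orbit f x, forall y, y \in A}.
    by move=> _ /trajectP[i _ ->]; have [] := iso_iter i xA.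
  rewrite -(size_orbit f x) -(card_uniqP (orbit_uniq f x)).
  rewrite -(card_in_imset (f := h)); last by move=> u v /fA uA /fA vA;
    apply: h_inj.
  rewrite -(size_orbit g) -(card_uniqP (orbit_uniq g _)); apply: eq_card => y.
  apply/trajectP/imsetP => [[i _ ->]|[_ /trajectP[i _ ->] ->]].
    have [_ ->] := iso_iter i xA; exists (iter i f x) => //.
    by rewrite -fconnect_orbit fconnect_iter.
  have [_ <-] := iso_iter i xA; apply/trajectP.
  by rewrite -[traject _ _ _]/(orbit g (h x)) -fconnect_orbit fconnect_iter.
rewrite /orbit ord; move: (order f x) {cx ord} => k.
elim: k x xA => //= k IH y yA.
by rewrite iso_tree_label // iso_next // IH // iso_stable.
Qed.

(** The starting points of the rotations may differ on both sides, but their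
maximum is attained at corresponding vertices. *)
Lemma iso_component_label : component_label f A = component_label g B.
Proof.
case/componentsP: (compA) => a defA; case/componentsP: (compB) => b defB.
have [r [cr ra lr r_max]] := component_labelP f a.
have rA : r \in A by rewrite defA mem_component ra.
have hB : component g (h r) = component g b.
  by apply/eqP; rewrite -mem_component -defB -hAB imset_f.
have chr : on_cycle g (h r) by rewrite iso_on_cycle.
rewrite defB -hB component_label_unique // => [|s cs shr].
  by rewrite iso_cycle_word // defA.
have: s \in B by rewrite defB mem_component shr hB.
rewrite -hAB => /imsetP[t tA st]; rewrite st iso_on_cycle // in cs.
rewrite st !iso_cycle_word //; apply: r_max => //.
by apply/eqP; rewrite -mem_component -defA.
Qed.

End IsomorphismToLabel.

Theorem component_label_canonical : canonical component_label.
Proof.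
move=> n f m g A B compA compB; split=> [AB|[h [h_inj hAB h_arc]]]; last first.
  exact: iso_component_label h_inj hAB h_arc.
case/componentsP: compA AB => a ->; case/componentsP: compB => b ->.
have [r [cr <- -> _]] := component_labelP f a.
have [s [cs <- -> _]] := component_labelP g b.
exact: cycle_word_isomorphic.
Qed.

(** * Tries *)

Lemma mem_trie_nodes L p : (p \in trie_nodes L) = has (prefix p) L.
Proof.
rewrite mem_undup; apply/allpairsPdep/hasP => [[s [i [sL _ ->]]]|[s sL ps]].
  by exists s => //; apply: prefix_take.
exists s, (size p); rewrite mem_iota /= add0n ltnS size_prefix //.
by split=> //; apply/esym/eqP; rewrite -prefixE.
Qed.

Lemma trie_nodes_uniq L : uniq (trie_nodes L).
Proof. exact: undup_uniq. Qed.

(** A node other than the root is a nonempty prefix of a stored string and can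
be charged to the last bit of this prefix. *)
Lemma trie_size_le L : trie_size L <= (sumn (map size L)).+1.
Proof.
pose N := [::] :: flatten [seq [seq take i s | i <- iota 1 (size s)] | s <- L]
  : seq bits.
have -> : (sumn (map size L)).+1 = size N.
  rewrite /N /= size_flatten /shape -map_comp; congr (_.+1).
  by congr sumn; apply: eq_map => s /=; rewrite size_map size_iota.
apply: uniq_leq_size; first exact: trie_nodes_uniq.
move=> p; rewrite mem_trie_nodes inE => /hasP[s sL ps].
case: (posnP (size p)) => [/size0nil->//|p0]; apply/orP; right.
apply/flatten_mapP; exists s => //; apply/mapP; exists (size p).
  by rewrite mem_iota p0 add1n ltnS size_prefix.
by apply/esym/eqP; rewrite -prefixE.
Qed.

Lemma trie_size_labels n (f : 'I_n -> 'I_n) :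
  trie_size (component_labels f) <= (2 * n).+1.
Proof.
apply: leq_trans (trie_size_le _) _; rewrite ltnS -(sum_component_labels f).
by rewrite /component_labels -map_comp sumnE big_map big_enum.
Qed.

(** * A program logic counting bit comparisons *)

Fixpoint value (s : store) (e : exp) : nat :=
  match e with
  | Const k => k
  | Get a e1 => word s a (value s e1)
  | Add e1 e2 => value s e1 + value s e2
  | Sub e1 e2 => value s e1 - value s e2
  end.

Definition bvalue (s : store) (b : bexp) : bool :=
  match b with Bit x => x | GetBit a e => bit s a (value s e) end.

Fixpoint leaves (e : exp) : nat :=
  match e with
  | Const _ => 1
  | Get _ _ => 1
  | Add e1 e2 => leaves e1 + leaves e2
  | Sub e1 e2 => leaves e1 + leaves e2
  end.

(** On a store with words at most [bound n], an expression built from constants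
up to 2 by at most six additions and subtractions stays below [8 * bound n]. *)
Fixpoint small (e : exp) : bool :=
  match e with
  | Const k => k <= 2
  | Get _ e1 => small e1 && (leaves e1 <= 7)
  | Add e1 e2 => small e1 && small e2
  | Sub e1 e2 => small e1 && small e2
  end && (leaves e <= 7).

Definition bsmall (b : bexp) : bool :=
  if b is GetBit _ e then small e else true.

Fixpoint writes (c : cmd) : seq (bool * nat) :=
  match c with
  | Skip => [::]
  | Put a _ _ => [:: (true, a)]
  | PutBit a _ _ => [:: (false, a)]
  | Seq c1 c2 | If _ _ c1 c2 => writes c1 ++ writes c2
  | While _ _ c1 => writes c1
  end.

Definition unchanged (W : seq (bool * nat)) (s s' : store) : Prop :=
  (forall a i, (true, a) \notin W -> word s' a i = word s a i) /\
  (forall a i, (false, a) \notin W -> bit s' a i = bit s a i).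

Lemma unchanged_trans W s1 s2 s3 :
  unchanged W s1 s2 -> unchanged W s2 s3 -> unchanged W s1 s3.
Proof.
by move=> [w12 b12] [w23 b23]; split=> a i aW; rewrite ?w23 ?w12 ?b23 ?b12.
Qed.

Lemma unchanged_sub W W' s s' :
  {subset W <= W'} -> unchanged W s s' -> unchanged W' s s'.
Proof.
move=> WW' [w b]; split=> a i aW; [apply: w|apply: b]; exact: contra (WW' _) aW.
Qed.

Lemma unchanged_all W W' s s' :
  all (fun x => x \in W') W -> unchanged W s s' -> unchanged W' s s'.
Proof. by move/allP; apply: unchanged_sub. Qed.

(** The frame property, which lets the invariants mention only the arrays that
are written. *)
Lemma exec_unchanged M c s t s' : exec M c s t s' -> unchanged (writes c) s s'.
Proof.
elim=> {c s t s'} //=.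
- move=> s a e1 e2 i x _ _; split=> //= b j; rewrite inE xpair_eqE /=.
  by rewrite /update => /negPf->.
- move=> s a e b i x _ _; split=> //= c j; rewrite inE xpair_eqE /=.
  by rewrite /update => /negPf->.
- move=> c1 c2 s1 s2 s3 t1 t2 _ u1 _ u2; apply: (@unchanged_trans _ _ s2).
    by apply: unchanged_sub u1 => x; rewrite mem_cat => ->.
  by apply: unchanged_sub u2 => x; rewrite mem_cat orbC => ->.
- move=> b1 b2 c1 c2 s s' t x1 x2 _ _ _; case: ifP => _;
    by apply: unchanged_sub => x; rewrite mem_cat => ->; rewrite ?orbT.
- by move=> b1 b2 c s1 s2 s3 t1 t2 x _ _ _ u1 _ u2;
  apply: unchanged_trans u1 u2.
Qed.

Section Logic.

Variable n : nat.

Definition bound := 2 * n + 2.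

Lemma leq_bound : n <= bound.
Proof. by rewrite /bound; lia. Qed.

Definition capacity := 8 * bound.

Definition bounded (s : store) := forall a i, word s a i <= bound.

Lemma eval_small s e : bounded s -> small e ->
  eval capacity s e = Some (value s e) /\ value s e <= leaves e * bound.
Proof.
move=> bs; have fits x l : x <= l * bound -> l <= 7 -> fit capacity x = Some x.
  move=> xl l7; rewrite /fit ifT // /capacity.
  have : l * bound <= 7 * bound by rewrite leq_mul2r l7 orbT.
  rewrite /bound in xl *; lia.
elim: e => [k|a e IH|e1 IH1 e2 IH2|e1 IH1 e2 IH2] /=.
- move=> /andP[k2 _]; have kb : k <= 1 * bound by rewrite /bound; lia.
  by rewrite (fits _ 1).
- move=> /andP[/andP[se le] _]; have [-> _] := IH se => /=.
  by rewrite (fits _ 1) ?mul1n.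
- move=> /andP[/andP[s1 s2] l]; have [-> v1] := IH1 s1;
  have [-> v2] := IH2 s2 => /=.
  have v12 : value s e1 + value s e2 <= (leaves e1 + leaves e2) * bound by lia.
  by rewrite (fits _ _ v12).
- move=> /andP[/andP[s1 s2] l]; have [-> v1] := IH1 s1;
  have [-> v2] := IH2 s2 => /=.
  have v12 : value s e1 - value s e2 <= (leaves e1 + leaves e2) * bound by lia.
  by rewrite (fits _ _ v12).
Qed.

Lemma beval_small s b : bounded s -> bsmall b ->
  beval capacity s b = Some (bvalue s b).
Proof. by case: b => [x|a e] //= bs /(eval_small bs)[->]. Qed.

(** A triple with total correctness and at most [T] bit comparisons.  It
carries the bound on the words along, so that a rule has to bound only the
value that is written. *)
Definition runs c s T (Q : store -> Prop) : Prop :=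
  bounded s -> exists t s',
    [/\ exec capacity c s t s', t <= T, bounded s' & Q s'].

Lemma runs_weaken c s T T' (Q Q' : store -> Prop) :
  runs c s T Q -> T <= T' ->
  (forall s', unchanged (writes c) s s' -> Q s' -> Q' s') -> runs c s T' Q'.
Proof.
move=> r TT QQ /r[t [s' [ex tT bs' Qs']]]; exists t, s'; split=> //.
  exact: leq_trans TT.
by apply: QQ => //; apply: exec_unchanged ex.
Qed.

Lemma runs_skip s T (Q : store -> Prop) : Q s -> runs Skip s T Q.
Proof. by move=> Qs bs; exists 0, s; split=> //; apply: ExecSkip. Qed.

Lemma runs_put a e1 e2 s T (Q : store -> Prop) :
  small e1 && small e2 -> value s e2 <= bound ->
  Q (set_word s a (value s e1) (value s e2)) -> runs (Put a e1 e2) s T Q.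
Proof.
move=> /andP[s1 s2] le2 Qs bs; exists 0, (set_word s a (value s e1) (value s
  e2)).
have [e1v _] := eval_small bs s1; have [e2v _] := eval_small bs s2.
split=> //; first exact: ExecPut.
by move=> b j /=; rewrite /update; case: ifP.
Qed.

Lemma runs_copy a e1 b e2 s T (Q : store -> Prop) :
  small e1 && small (Get b e2) ->
  Q (set_word s a (value s e1) (word s b (value s e2))) ->
  runs (Put a e1 (Get b e2)) s T Q.
Proof.
by move=> sm Qs bs; exact: (@runs_put a e1 (Get b e2) s T Q sm (bs _ _) Qs bs).
Qed.

Lemma runs_putbit a e b s T (Q : store -> Prop) :
  small e && bsmall b ->
  Q (set_bit s a (value s e) (bvalue s b)) -> runs (PutBit a e b) s T Q.
Proof.
move=> /andP[s1 s2] Qs bs; exists 0, (set_bit s a (value s e) (bvalue s b)).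
have [e1v _] := eval_small bs s1.
by split=> //; apply: ExecPutBit => //; apply: beval_small.
Qed.

Lemma runs_seq c1 c2 s T1 T2 T Q : T1 + T2 <= T ->
  runs c1 s T1 (fun s' => unchanged (writes c1) s s' -> runs c2 s' T2 Q) ->
  runs (Seq c1 c2) s T Q.
Proof.
move=> TT r1 /r1[t1 [s1 [ex1 tT1 bs1 r2]]].
have [t2 [s2 [ex2 tT2 bs2 Q2]]] := r2 (exec_unchanged ex1) bs1.
exists (t1 + t2), s2; split=> //; first exact: ExecSeq ex1 ex2.
by apply: leq_trans TT; apply: leq_add.
Qed.

Lemma runs_seq0 c1 c2 s T Q :
  runs c1 s 0 (fun s' => runs c2 s' T Q) -> runs (Seq c1 c2) s T Q.
Proof.
move=> r1; apply: (@runs_seq _ _ _ 0 T) => //.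
by apply: (runs_weaken r1).
Qed.

Lemma runs_if b1 b2 c1 c2 s T Q : bsmall b1 && bsmall b2 -> 0 < T ->
  (if bvalue s b1 == bvalue s b2 then runs c1 s T.-1 Q else runs c2 s T.-1 Q) ->
  runs (If b1 b2 c1 c2) s T Q.
Proof.
move=> /andP[s1 s2] T0 r bs.
have : runs (if bvalue s b1 == bvalue s b2 then c1 else c2) s T.-1 Q.
  by move: r; case: ifP.
case/(_ bs) => t [s' [ex tT bs' Qs']]; exists t.+1, s'; split=> //; last by lia.
by apply: ExecIf ex; apply: beval_small.
Qed.

(** The index of the invariant is the number of comparisons that may still be
spent.  It decreases with every iteration and thus proves termination too. *)
Lemma runs_while b1 b2 c s0 T (I : nat -> store -> Prop) Q :
    bsmall b1 && bsmall b2 -> I T s0 ->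
    (forall k s, unchanged (writes c) s0 s -> I k s -> 0 < k /\
      if bvalue s b1 == bvalue s b2
      then exists k1 k2, k1 + k2 < k /\ runs c s k1 (I k2)
      else Q s) ->
  runs (While b1 b2 c) s0 T Q.
Proof.
move=> /andP[s1 s2] IT step.
suff: forall k s, unchanged (writes c) s0 s -> I k s ->
  runs (While b1 b2 c) s k Q.
  by apply.
move=> k; have [m] := ubnP k; elim: m k => // m IH k km s u Ik bs.
have [k0] := step k s u Ik; case: ifP => [/eqP e|/negbT ne Qs].
  case=> k1 [k2 [k12]] /(_ bs)[t1 [s' [ex1 tk1 bs' Ik2]]].
  have u' := unchanged_trans u (exec_unchanged ex1).
  have [|t2 [s'' [ex2 tk2 bs'' Qs'']]] := IH k2 _ s' u' Ik2 bs'; first by lia.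
  exists (t1 + t2).+1, s''; split=> //; last by lia.
  by apply: ExecWhileLoop ex1 ex2; rewrite beval_small // e.
exists 1, s; split=> //; exact: ExecWhileDone (beval_small bs s1) (beval_small
  bs s2) ne.
Qed.

End Logic.

(** Control depends on bits only.  Once the array [ZERO] holds the indicator of
0, the bit [null e] tells whether the word [e] is 0; with truncated subtraction
this decides equality ([dist]) and order. *)
Definition ZERO := 4.

Definition var a := Get a (Const 0).
Definition set a e := Put a (Const 0) e.
Definition null e := GetBit ZERO e.
Definition dist e1 e2 := Add (Sub e1 e2) (Sub e2 e1).
Definition incr a e k := Put a e (Add (Get a e) k).

Definition For i e c :=
  Seq (set i (Const 0))
    (While (null (Sub e (var i))) (Bit false)
       (Seq c (incr i (Const 0) (Const 1)))).

Definition zeros (s : store) := forall x, bit s ZERO x = (x == 0).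

(** The iterations may have different costs, which is what amortised bounds
need. *)
Lemma runs_for_sum n i e c s0 N (T : nat -> nat) T'
    (I : nat -> store -> Prop) Q :
    small (Sub e (var i)) -> (false, ZERO) \notin writes c ->
    (true, i) \notin writes c ->
    zeros s0 -> N <= bound n -> \sum_(0 <= k < N) (T k).+1 < T' ->
    (forall s, unchanged (writes (For i e c)) s0 s -> value s e = N) ->
    I 0 (set_word s0 i 0 0) ->
    (forall k s, k < N -> unchanged (writes (For i e c)) s0 s ->
      word s i 0 = k ->
       I k s -> runs n c s (T k) (fun s' => I k.+1 (set_word s' i 0 k.+1))) ->
    (forall s, unchanged (writes (For i e c)) s0 s -> word s i 0 = N ->
      I N s -> Q s) ->
  runs n (For i e c) s0 T' Q.
Proof.
move=> se zW iW z0 NB le_T' eN I0 step post.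
apply: runs_seq0; apply: runs_put => //=.
set s1 := set_word s0 i 0 0.
pose J t s := exists k,
  [/\ t = (\sum_(k <= j < N) (T j).+1).+1, k <= N, word s i 0 = k & I k s].
apply: (@runs_weaken _ _ _ (\sum_(0 <= j < N) (T j).+1).+1 _ Q) => //.
apply: (@runs_while _ _ _ _ _ _ J) => /=; first by move: se => /=;
  rewrite andbT.
  by exists 0; rewrite /= /update !eqxx.
have u1 : unchanged (writes (For i e c)) s0 s1.
  split=> // a j; rewrite inE xpair_eqE negb_or /= /update.
  by case/andP=> /negPf->.
move=> t s u [k [-> kN ik Ik]]; split=> //.
have us : unchanged (writes (For i e c)) s0 s.
  apply: unchanged_trans u1 _; apply: unchanged_sub u => x.
  by rewrite !inE !mem_cat => ->; rewrite orbT.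
have zs x : bit s ZERO x = (x == 0).
  by rewrite us.2 ?z0 // !inE /= !mem_cat /= inE (negPf zW).
rewrite zs eN // ik; case: (ltnP k N) => [kN'|Nk]; last first.
  have -> : N - k == 0 by rewrite subn_eq0.
  by apply: post; rewrite ?ik //; have -> : N = k by lia.
have -> : (N - k == 0) = false by lia.
exists (T k), (\sum_(k.+1 <= j < N) (T j).+1).+1; split.
  by rewrite (big_ltn kN') /=; lia.
apply: (@runs_seq _ _ _ _ (T k) 0); first by rewrite addn0.
apply: (runs_weaken (step k s kN' us ik Ik)) => // s' u' Ik' u''.
have ik' : word s' i 0 = k by rewrite u''.1.
apply: runs_put => //=; rewrite ik' addn1; first exact: leq_trans NB.
by exists k.+1; rewrite /= /update !eqxx.
Qed.

Lemma runs_for n i e c s0 N T T'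
    (I : nat -> store -> Prop) Q :
    small (Sub e (var i)) -> (false, ZERO) \notin writes c ->
    (true, i) \notin writes c ->
    zeros s0 -> N <= bound n -> N * T.+1 < T' ->
    (forall s, unchanged (writes (For i e c)) s0 s -> value s e = N) ->
    I 0 (set_word s0 i 0 0) ->
    (forall k s, k < N -> unchanged (writes (For i e c)) s0 s ->
      word s i 0 = k ->
       I k s -> runs n c s T (fun s' => I k.+1 (set_word s' i 0 k.+1))) ->
    (forall s, unchanged (writes (For i e c)) s0 s -> word s i 0 = N ->
      I N s -> Q s) ->
  runs n (For i e c) s0 T' Q.
Proof.
move=> se zW iW z0 NB le_T'; apply: runs_for_sum => //.
by rewrite sum_nat_const_nat subn0.
Qed.

(** * Finding cycles and components *)

Arguments update /.

Notation "c1 ;; c2" := (Seq c1 c2) (at level 60, right associativity).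

Definition VERTEX := 10.
Definition CURSOR := 11.
Definition VALUE := 12.
Definition STAMP := 13.
Definition DEPTH := 14.
Definition NUMBER := 15.

(** Follows the arcs and writes [VALUE] on the way until it meets this value.
Since each walk has a value of its own, no marks have to be erased. *)
Definition stamp a :=
  While (null (dist (Get a (var CURSOR)) (var VALUE))) (Bit false)
    (Put a (var CURSOR) (var VALUE) ;; set CURSOR (Get SUCC (var CURSOR))).

(** The first vertex to be repeated on the path of [v] is [v] itself exactly
when [v] is on a cycle. *)
Definition find_cycles :=
  For VERTEX (var ORDER)
    (set VALUE (Add (var VERTEX) (Const 1)) ;;
     set CURSOR (var VERTEX) ;;
     stamp STAMP ;;
     PutBit CYCLE (var VERTEX) (null (dist (var CURSOR) (var VERTEX)))).

Definition find_root :=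
  set CURSOR (var VERTEX) ;;
  While (GetBit CYCLE (var CURSOR)) (Bit false)
    (set CURSOR (Get SUCC (var CURSOR)) ;;
     incr DEPTH (var VERTEX) (Const 1)) ;;
  Put ROOT (var VERTEX) (var CURSOR).

(** [NUMBER] holds the number of the component plus one on the cycles that have
been numbered, and 0 on the others. *)
Definition number_components :=
  For VERTEX (var ORDER)
    (find_root ;;
     If (null (Get NUMBER (var CURSOR))) (Bit true)
       (incr NCOMP (Const 0) (Const 1) ;;
        set VALUE (var NCOMP) ;;
        stamp NUMBER)
       Skip ;;
     Put COMP (var VERTEX)
       (Sub (Get NUMBER (Get ROOT (var VERTEX))) (Const 1))).

Definition phase1 :=
  PutBit ZERO (Const 0) (Bit true) ;; find_cycles ;; number_components.

Lemma dist_eq0 x y : (x - y + (y - x) == 0) = (x == y).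
Proof. lia. Qed.

Section Phase1.

Variables (n : nat) (f : 'I_n -> 'I_n).
Let K := max_component_size f.

Definition loaded (s : store) : Prop :=
  [/\ zeros s, word s ORDER 0 = n & forall v : 'I_n, word s SUCC v = f v].

Lemma loaded_unchanged W s s' : unchanged W s s' ->
    [&& (false, ZERO) \notin W, (true, ORDER) \notin W &
      (true, SUCC) \notin W] ->
  loaded s -> loaded s'.
Proof.
move=> [w b] /and3P[Z O S] [z o su]; split=> [x||v].
- by rewrite b // z.
- by rewrite w.
- by rewrite w.
Qed.

(** The orbit of [x] lists the distinct iterates, so the first repetition
occurs after [order f x] steps. *)
Lemma runs_stamp (a : nat) s (x : 'I_n) val T (Q : store -> Prop) :
    (a \notin [:: SUCC; CURSOR; VALUE; ORDER]) -> loaded s ->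
    word s CURSOR 0 = x -> word s VALUE 0 = val ->
    {in orbit f x, forall u : 'I_n, word s a u != val} -> order f x < T ->
    (forall s', unchanged [:: (true, a); (true, CURSOR)] s s' ->
       word s' CURSOR 0 = iter (order f x) f x ->
       (forall u : 'I_n, word s' a u = if u \in orbit f x then val else word s
         a u) ->
       Q s') ->
  runs n (stamp a) s T Q.
Proof.
rewrite !inE !negb_or => /and4P[aS aC aV aO] ld Cx Vv fresh oT post.
apply: (@runs_weaken _ _ _ (order f x).+1 _ Q) => //.
pose J t s' := exists j, [/\ t = (order f x - j).+1, j <= order f x,
  word s' CURSOR 0 = iter j f x & forall u : 'I_n,
  word s' a u = if u \in traject f x j then val else word s a u].
apply: (@runs_while _ _ _ _ _ _ J) => //=; first by exists 0; rewrite subn0.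
move=> t s' u [j [-> jo Cj aj]]; split=> //.
have ld' : loaded s'.
  apply: loaded_unchanged u _ ld.
  by rewrite !inE !xpair_eqE /= !orbF ![_ == a]eq_sym aO aS.
have [z' _ S'] := ld'.
have V' : word s' VALUE 0 = val by rewrite u.1 // !inE !xpair_eqE /= orbF
  eq_sym.
rewrite z' dist_eq0 Cj aj V'.
have [jin|jnin] := boolP (iter j f x \in traject f x j).
  rewrite eqxx /=.
  (* A repetition before the end of the orbit contradicts its uniqueness. *)
  have ejo : j = order f x.
    apply/eqP; move: jo; rewrite leq_eqVlt => /orP[//|jo].
    have := orbit_uniq f x; rewrite /orbit -(subnKC jo) trajectD cat_uniq.
    by rewrite trajectSr rcons_uniq jin.
  apply: post => //; first by rewrite Cj ejo.
  by move=> w; rewrite aj ejo.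
have jo' : j < order f x.
  rewrite ltn_neqAle jo andbT; apply: contra jnin => /eqP->.
  by rewrite -[traject _ _ _]/(orbit f x) -fconnect_orbit fconnect_iter.
rewrite (negPf (fresh _ _)) /=; last by apply/trajectP; exists j.
exists 0, (order f x - j.+1).+1; split; first by lia.
apply: runs_seq0; apply: runs_copy => //=; apply: runs_copy => //=.
exists j.+1; split=> // [|w] /=.
  by rewrite ![_ == a]eq_sym (negPf aC) (negPf aS) /= Cj S'.
rewrite -[x :: _]/(traject f x j.+1) trajectSr mem_rcons inE.
rewrite (negPf aC) eqxx /= Cj aj V' -(inj_eq val_inj) /=.
by case: ifP.
Qed.

Lemma runs_find_cycles s T :
    loaded s -> (forall i, word s STAMP i = 0) -> n * K.+2 < T ->
  runs n find_cycles s T (fun s' =>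
    forall v : 'I_n, bit s' CYCLE v = on_cycle f v).
Proof.
move=> ld st0 le_T.
pose I k s' := (forall v : 'I_n, word s' STAMP v <= k) /\
  (forall v : 'I_n, v < k -> bit s' CYCLE v = on_cycle f v).
have [z0 o0 _] := ld.
apply: (@runs_for _ _ _ _ _ n K.+1 _ I) => //; first exact: leq_bound.
- by move=> s' u /=; rewrite u.1.
- by split=> // v /=; rewrite st0.
- move=> k s' kn u Vk [stk cyk]; pose v := Ordinal kn.
  have ld' : loaded s' by apply: loaded_unchanged u _ ld.
  apply: runs_seq0; apply: runs_put => //=; first by rewrite Vk /bound; lia.
  apply: runs_seq0; apply: runs_copy => //=.
  apply: (@runs_seq _ _ _ _ K.+1 0); rewrite ?addn0 //.
  apply: (@runs_stamp STAMP _ v k.+1) => //=.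
  + by rewrite Vk addn1.
  + by move=> w _; rewrite neq_ltn ltnS stk.
  + by rewrite ltnS order_le_max.
  move=> s1 u1 C1 st1 _; apply: runs_putbit => //=.
  have V1 : word s1 VERTEX 0 = k by rewrite u1.1 //= Vk.
  have [z1 _ _] : loaded s1 by apply: loaded_unchanged u1 _ ld'.
  rewrite z1 V1 dist_eq0 C1; split=> w /=.
    by rewrite st1; case: ifP => // _; apply: leqW; apply: stk.
  rewrite ltnS leq_eqVlt -[w == k :> nat]/(w == v) => wk.
  case: eqVneq wk => [-> _|wv wk]; first by rewrite on_cycle_order.
  by rewrite u1.2 // cyk.
- by move=> s' _ _ [_ cy] v; apply: cy.
Qed.

(** [cs] lists the components numbered so far in the order of their numbers. *)
Definition numbers (cs : seq {set 'I_n}) (s : store) : Prop :=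
  [/\ uniq cs, word s NCOMP 0 = size cs
    & forall u : 'I_n, on_cycle f u -> word s NUMBER u =
        if component f u \in cs then (index (component f u) cs).+1 else 0].

Lemma runs_find_root s (v : 'I_n) T :
    loaded s -> word s VERTEX 0 = v ->
      (forall u : 'I_n, bit s CYCLE u = on_cycle f u) ->
    word s DEPTH v = 0 -> depth f v < T ->
  runs n find_root s T (fun s' => [/\ word s' CURSOR 0 = tree_root f v,
    forall u : 'I_n, word s' DEPTH u =
      if u == v then depth f v else word s DEPTH u
  & forall u : 'I_n,
    word s' ROOT u = if u == v then tree_root f v : nat else word s ROOT u]).
Proof.
move=> ld Vv cyc D0 dT; have [z0 _ S0] := ld.
apply: runs_seq0; apply: runs_copy => //=; rewrite Vv;
  set s1 := set_word _ _ _ _.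
pose J t s' := exists i, [/\ t = (depth f v - i).+1, i <= depth f v,
  word s' CURSOR 0 = iter i f v & forall u : 'I_n,
  word s' DEPTH u = if u == v then i else word s DEPTH u].
apply: (@runs_seq _ _ _ _ T 0); rewrite ?addn0 //.
apply: (@runs_weaken _ _ _ (depth f v).+1 _ (fun s' =>
  word s' CURSOR 0 = tree_root f v /\
  forall u : 'I_n, word s' DEPTH u =
    if u == v then depth f v else word s DEPTH u)) => //.
  apply: (@runs_while _ _ _ _ _ _ J) => //=.
    exists 0; rewrite subn0; split=> // u.
    by case: eqVneq => // ->.
  move=> t s' u [i [-> id Ci Di]]; split=> //.
  rewrite u.2 //= Ci cyc eqbF_neg.
  case: (ltnP i (depth f v)) => [lt_i|ge_i].
    rewrite before_depth //; exists 0, (depth f v - i.+1).+1; split;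
      first by lia.
    have Vs' : word s' VERTEX 0 = v by rewrite u.1.
    apply: runs_seq0; apply: runs_copy => //=; apply: runs_put => //=.
      by rewrite Vs' Di eqxx; have := depth_lt f v; rewrite /bound; lia.
    exists i.+1; split=> // [|w] /=; first by rewrite Ci u.1 //= S0.
    by rewrite Vs' !Di eqxx addn1 -!(inj_eq val_inj) /=; case: eqP.
  have ed : i = depth f v by lia.
  rewrite ed -tree_rootE tree_root_on_cycle /=; split=> // w.
  by rewrite Di ed.
move=> s' u [C' D'] u'; apply: runs_copy => //=; split=> // w.
by rewrite u.1 //= Vv C' (inj_eq val_inj) ?andbT u.1.
Qed.

Lemma runs_number_components s T :
    loaded s -> (forall u : 'I_n, bit s CYCLE u = on_cycle f u) ->
    (forall a i : nat, a \in [:: DEPTH; NUMBER; NCOMP] -> word s a i = 0) ->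
    n * (2 * K + 4) < T ->
  runs n number_components s T (fun s' => exists cs,
    [/\ uniq cs, cs =i components f, word s' NCOMP 0 = size cs
      & forall v : 'I_n, [/\ word s' DEPTH v = depth f v,
          word s' ROOT v = tree_root f v
        & word s' COMP v = index (component f v) cs]]).
Proof.
move=> ld cyc init le_T; have [z0 o0 _] := ld.
pose I k s' := (forall v : 'I_n, k <= v -> word s' DEPTH v = 0) /\ exists cs,
  [/\ numbers cs s', size cs <= k,
      (forall A, A \in cs <-> exists2 v : 'I_n, v < k & A = component f v)
    & forall v : 'I_n, v < k -> [/\ word s' DEPTH v = depth f v,
          word s' ROOT v = tree_root f v
        & word s' COMP v = index (component f v) cs]].
apply: (@runs_for _ _ _ _ _ n (2 * K + 3) _ I) => //; first exact: leq_bound.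
- by rewrite -addnS.
- by move=> s' u /=; rewrite u.1.
- split=> [v _|]; first by rewrite /= init.
  exists [::]; split=> // [|A]; last by split=> // -[].
  by split=> // [|u _]; rewrite /= init.
- move=> k s' kn u Vk [D0 [cs [nums szk csP done]]]; pose v := Ordinal kn.
  have ld' : loaded s' by apply: loaded_unchanged u _ ld.
  apply: (@runs_seq _ _ _ _ K (K + 3)); first by lia.
  apply: (runs_weaken (@runs_find_root s' v K ld' Vk _ _ _)) => //=.
  + by move=> w; rewrite u.2.
  + exact: (D0 v (leqnn k)).
  + exact: depth_lt_max.
  move=> s1 u1 [C1 D1 R1] _.
  have ld1 : loaded s1 by apply: loaded_unchanged u1 _ ld'.
  have [z1 _ _] := ld1.
  pose Mid cs' s2 := [/\ numbers cs' s2, size cs' <= k.+1 &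
    forall A, (A \in cs') = (A \in cs) || (A == component f v)].
  apply: (@runs_seq _ _ _ _ (K + 3) 0); first by rewrite addn0.
  apply: (@runs_weaken _ _ _ (K + 3) _ (fun s2 => exists cs', Mid cs' s2 /\
    {in cs, forall A, index A cs' = index A cs})) => //; last first.
    move=> s2 u2 [cs' [[[ucs' sz' num'] szcs' csE] idx]] _.
    have V2 : word s2 VERTEX 0 = k by rewrite u2.1 // u1.1.
    have R2 w : word s2 ROOT w = word s1 ROOT w by rewrite u2.1.
    have vcs' : component f v \in cs' by rewrite csE eqxx orbT.
    have N2 : word s2 NUMBER (word s2 ROOT k) = (index (component f v) cs').+1.
      have := R1 v; rewrite eqxx /= => Rk; rewrite R2 Rk.
      by rewrite num' ?tree_root_on_cycle // component_root vcs'.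
    apply: runs_put => //=; rewrite V2 N2 subn1 /=.
      apply: leq_trans (index_size _ _) (leq_trans szcs' _).
      by rewrite /bound; lia.
    split=> [w kw|] /=; last exists cs'.
      rewrite u2.1 // D1; case: eqVneq kw => [->|_] kw;
        first by rewrite ltnn in kw.
      by rewrite D0 // ltnW.
    split=> //=.
      move=> A; rewrite csE; split=> [/orP[/csP[w wk ->]|/eqP->]|[w wk ->]].
      - by exists w; rewrite // ltnW.
      - by exists v => /=.
      case: (eqVneq w v) => [->|wv]; first by rewrite eqxx orbT.
      apply/orP; left; apply/csP; exists w => //.
      by rewrite -(inj_eq val_inj) /= in wv; lia.
    move=> w wk; rewrite u2.1 // R2 D1 R1 -[w == k :> nat]/(w == v).
    have [->//|wv] := eqVneq w v.
    have wk' : w < k by rewrite -(inj_eq val_inj) /= in wv; lia.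
    have [Dw Rw Cw] := done w wk'; rewrite u2.1 // u1.1 // Cw idx //.
    by apply/csP; exists w.
  have [ucs szcs numcs] := nums.
  have num1 : numbers cs s1.
    by split=> // [|w cw]; rewrite u1.1 // numcs.
  have cr := tree_root_on_cycle f v.
  apply: runs_if => //; first by lia.
  have [_ _ /(_ _ cr)] := num1 => numr.
  rewrite /= z1 C1 numr component_root.
  have [vin|vnin] /= := boolP (component f v \in cs).
    apply: runs_skip; exists cs; split=> //; split=> //; first exact: leqW.
    by move=> A; case: eqVneq => [->|]; rewrite ?vin ?orbF.
  have [_ sz1 _] := num1.
  apply: runs_seq0; apply: runs_put => //=; first by rewrite sz1 /bound; lia.
  apply: runs_seq0; apply: runs_copy => //=; rewrite sz1.
  have stamped := @runs_stamp NUMBER _ (tree_root f v) (size cs).+1.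
  apply: stamped => //=.
  + by rewrite addn1.
  + move=> w; rewrite mem_orbit_component // => /andP[cw /eqP wv].
    have [_ _ /(_ _ cw) ->] := num1.
    by rewrite wv component_root (negPf vnin).
  + by have := order_le_max f (tree_root f v); rewrite -/K; lia.
  move=> s2 u2 C2 N2; exists (rcons cs (component f v)); split; last first.
    by move=> A Acs; rewrite -cats1 index_cat Acs.
  split; last by move=> A; rewrite mem_rcons inE orbC.
    split; first by rewrite rcons_uniq vnin.
      by rewrite u2.1 //= size_rcons addn1.
    move=> w cw; rewrite N2 mem_rcons inE mem_orbit_component // cw /=
      component_root.
    rewrite -cats1 index_cat /=; case: eqVneq => [->|wv] /=;
      first by rewrite (negPf vnin) addn0.
    have [_ _ ->] := num1 => //; by case: ifP.
  by rewrite size_rcons ltnS.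
- move=> s' u _ [_ [cs [[ucs szcs _] _ csP done]]]; exists cs; split=> //.
    move=> A; apply/idP/componentsP => [/csP[v _]|[v Av]]; first by exists v.
    by apply/csP; exists v.
  by move=> v; apply: done.
Qed.

Definition identified (cs : seq {set 'I_n}) (s : store) : Prop :=
  [/\ loaded s, uniq cs, cs =i components f, word s NCOMP 0 = size cs
    & forall v : 'I_n, [/\ bit s CYCLE v = on_cycle f v,
        word s DEPTH v = depth f v, word s ROOT v = tree_root f v
      & word s COMP v = index (component f v) cs]].

Lemma bounded_input : bounded n (input f).
Proof.
move=> a i; rewrite /= /bound; case: ifP => _; last by case: ifP => _; lia.
by case: insubP => [v _ _|_] //; have := ltn_ord (f v); lia.
Qed.

Lemma runs_phase1 : 0 < n ->
  runs n phase1 (input f) (14 * (K * n)) (fun s => exists cs, identified cs s).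
Proof.
move=> n0; have K0 : 0 < K := max_component_gt0 f n0.
have ld : loaded (set_bit (input f) ZERO 0 true).
  split=> [x||v] //=; first by case: eqP.
  by rewrite insubT //= => vn; congr (nat_of_ord (f _)); apply: val_inj.
apply: runs_seq0; apply: runs_putbit => //.
apply: (@runs_seq _ _ _ _ (n * K.+2).+1 (n * (2 * K + 4)).+1); first by nia.
apply: (runs_weaken (@runs_find_cycles _ _ ld _ (ltnSn _))) => // s1 u1 cyc _.
have ld1 : loaded s1 by apply: loaded_unchanged u1 _ ld.
apply: (runs_weaken (@runs_number_components s1 _ ld1 cyc _ (ltnSn _))) => //.
  by move=> a i; rewrite !inE => /or3P[]/eqP->; rewrite u1.1.
move=> s2 u2 [cs [ucs csE sz done]]; exists cs; split=> //.
  by apply: loaded_unchanged u2 _ ld1.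
by move=> v; have [dv rv cv] := done v; split=> //; rewrite u2.2.
Qed.

End Phase1.

(** * Sorted trees as linked lists of tokens *)

Definition MAXDEPTH := 16.
Definition LEVEL := 17.
Definition ROUND := 18.
Definition PARENT := 19.
Definition PREV := 20.
Definition SIBLING := 21.
Definition LEFT := 22.
Definition RIGHT := 23.
Definition COUNT := 24.
Definition STEP := 25.
Definition NEXT := 26.
Definition SIZE := 27.
Definition BEST := 28.
Definition POSITION := 29.
Definition INDEX := 30.

Definition STOP := 5.
Definition DIFFER := 6.
Definition LESS := 7.

(** The token [v] opens the vertex [v], the token [n + v] closes it, and the bit
of a token tells whether it is smaller than [n].  The links in [NEXT] chain the
tokens of a label. *)
Definition opening e := null (Sub (Add e (Const 1)) (var ORDER)).
Definition closing e := Add (var ORDER) e.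

(** Every list of children starts empty.  The closing tokens of the cycle
vertices already lead to the next cycle vertex, so that every component becomes
a circular list.  Truncated subtraction computes the maximal depth without a
test. *)
Definition init_lists :=
  For VERTEX (var ORDER)
    (Put NEXT (var VERTEX) (closing (var VERTEX)) ;;
     Put SIZE (var VERTEX) (Const 2) ;;
     set MAXDEPTH (Add (var MAXDEPTH) (Sub (Get DEPTH (var VERTEX)) (var
       MAXDEPTH))) ;;
     incr LENGTH (Get COMP (var VERTEX)) (Const 2) ;;
     If (GetBit CYCLE (var VERTEX)) (Bit true)
       (Put NEXT (closing (var VERTEX)) (Get SUCC (var VERTEX)) ;;
        Put BEST (Get COMP (var VERTEX)) (var VERTEX))
       Skip).

(** Compares the words of length [COUNT] that start at the tokens [LEFT] and
[RIGHT]; the first difference decides. *)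
Definition compare :=
  PutBit LESS (Const 0) (Bit false) ;;
  PutBit DIFFER (Const 0) (Bit false) ;;
  For STEP (var COUNT)
    (If (GetBit DIFFER (Const 0)) (Bit true) Skip
       (If (opening (var LEFT)) (opening (var RIGHT)) Skip
          (PutBit DIFFER (Const 0) (Bit true) ;;
           PutBit LESS (Const 0) (opening (var RIGHT)))) ;;
     set LEFT (Get NEXT (var LEFT)) ;;
     set RIGHT (Get NEXT (var RIGHT))).

(** Examines the sibling after the token [PREV], and moves beyond it unless its
label has a smaller value than the label of [VERTEX].  A longer label has a
larger value, so bits are compared only for labels of equal length. *)
Definition search_step :=
  set SIBLING (Get NEXT (var PREV)) ;;
  If (opening (var SIBLING)) (Bit true)
    (If (null (Sub (Get SIZE (var VERTEX)) (Get SIZE (var SIBLING)))) (Bit true)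
       (If (null (Sub (Get SIZE (var SIBLING)) (Get SIZE (var VERTEX)))) (Bit
         true)
          (set LEFT (var SIBLING) ;;
           set RIGHT (var VERTEX) ;;
           set COUNT (Get SIZE (var VERTEX)) ;;
           compare ;;
           PutBit STOP (Const 0) (GetBit LESS (Const 0)))
          Skip)
       (PutBit STOP (Const 0) (Bit true)) ;;
     If (GetBit STOP (Const 0)) (Bit false) (set PREV (closing (var SIBLING)))
       Skip)
    (PutBit STOP (Const 0) (Bit true)).

Definition insert :=
  set PARENT (Get SUCC (var VERTEX)) ;;
  set PREV (var PARENT) ;;
  PutBit STOP (Const 0) (Bit false) ;;
  While (GetBit STOP (Const 0)) (Bit false) search_step ;;
  Put NEXT (var PREV) (var VERTEX) ;;
  Put NEXT (closing (var VERTEX)) (var SIBLING) ;;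
  Put SIZE (var PARENT) (Add (Get SIZE (var PARENT)) (Get SIZE (var VERTEX))).

(** By decreasing depth, so that the list of a vertex is complete before the
vertex is inserted into the list of its parent.  Cycle vertices, of depth 0, are
left out. *)
Definition sort_children :=
  For ROUND (var MAXDEPTH)
    (set LEVEL (Sub (var MAXDEPTH) (var ROUND)) ;;
     For VERTEX (var ORDER)
       (If (null (dist (Get DEPTH (var VERTEX)) (var LEVEL))) (Bit true)
          insert Skip)).

Definition best_rotations :=
  For VERTEX (var ORDER)
    (If (GetBit CYCLE (var VERTEX)) (Bit true)
       (set LEFT (Get BEST (Get COMP (var VERTEX))) ;;
        set RIGHT (var VERTEX) ;;
        set COUNT (Get LENGTH (Get COMP (var VERTEX))) ;;
        compare ;;
        If (GetBit LESS (Const 0)) (Bit true)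
          (Put BEST (Get COMP (var VERTEX)) (var VERTEX)) Skip)
       Skip).

Definition write_labels :=
  For INDEX (var NCOMP)
    (Put START (var INDEX) (var POSITION) ;;
     set LEFT (Get BEST (var INDEX)) ;;
     For STEP (Get LENGTH (var INDEX))
       (PutBit LABEL (var POSITION) (opening (var LEFT)) ;;
        set LEFT (Get NEXT (var LEFT)) ;;
        incr POSITION (Const 0) (Const 1))).

Definition phase2 := init_lists ;; sort_children ;; best_rotations ;;
  write_labels.

(** * Reading and changing token lists *)

Section TokenLists.

Variable n : nat.
Implicit Types (nx : nat -> nat) (t e : nat) (l : seq 'I_n).

(** The tokens met from [t] on spell [w], and [e] is the token that comes
next. *)
Fixpoint reads nx t (w : bits) e : Prop :=
  if w is b :: w' then (t < n) = b /\ reads nx (nx t) w' e else t = e.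

Lemma reads_cat nx t w1 e1 w2 e2 :
  reads nx t w1 e1 -> reads nx e1 w2 e2 -> reads nx t (w1 ++ w2) e2.
Proof.
by elim: w1 t => /= [t ->|b w1 IH t [-> r1 r2]] //; split=> //; apply: IH.
Qed.

Lemma reads_ext nx nx' t w e : nx =1 nx' -> reads nx t w e -> reads nx' t w e.
Proof.
by move=> E; elim: w t => //= b w IH t [-> r]; rewrite -E; split=> //;
  apply: IH.
Qed.

Lemma reads_drop nx t w e k : k < size w -> reads nx t (drop k w) e ->
  (t < n) = nth false w k /\ reads nx (nx t) (drop k.+1 w) e.
Proof. by move=> kw; rewrite (drop_nth false kw). Qed.

(** From [t], the links enter the vertices of [l] one after the other and then
lead to [e]; the links inside their subtrees are left open. *)
Fixpoint links nx t l e : Prop :=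
  if l is u :: l' then nx t = u /\ links nx (n + u) l' e else nx t = e.

(** The token after which the next sibling of the vertices in [l] comes. *)
Definition last_token t l := last t [seq n + u | u : 'I_n <- l].

Lemma links_last nx t l1 l2 e : links nx t (l1 ++ l2) e ->
  nx (last_token t l1) = if l2 is u :: _ then nat_of_ord u else e.
Proof.
by elim: l1 t => [|u l1 IH] t /=; [case: l2 => [|u l2] // [] | case=> _ /IH].
Qed.

Lemma links_ext nx nx' t l e : nx' t = nx t ->
    {in l, forall u : 'I_n, nx' (n + u) = nx (n + u)} ->
  links nx t l e -> links nx' t l e.
Proof.
elim: l t => [|u l IH] t /= -> //= E [-> Ll]; split=> //.
by apply: IH => // [|w wl]; rewrite E // inE ?eqxx // wl orbT.
Qed.

Lemma last_token_cons t u l : last_token t (u :: l) = last_token (n + u) l.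
Proof. by []. Qed.

Lemma last_tokenP t l : last_token t l = t \/ exists2 u, u \in l &
  last_token t l = n + u.
Proof.
elim: l t => [|u l IH] t; first by left.
rewrite last_token_cons; case: (IH (n + u)) => [|[w wl]] ->; right.
  by exists u; rewrite ?mem_head.
by exists w; rewrite // inE wl orbT.
Qed.

(** Two links change: the one that leads to the place of [v], and the one that
leaves [v].  No other link of the list starts at these tokens. *)
Lemma links_insert nx nx' t l1 l2 e (v : 'I_n) :
    (forall x, nx' x = if x == n + v then nx (last_token t l1)
       else if x == last_token t l1 then v : nat else nx x) ->
    {in l1 ++ l2, forall u : 'I_n, t != n + u} -> t != n + v ->
    v \notin l1 ++ l2 -> uniq (l1 ++ l2) ->
  links nx t (l1 ++ l2) e -> links nx' t (l1 ++ v :: l2) e.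
Proof.
elim: l1 t => [|u l1 IH] t /= E tl tv.
  move=> vl ul Ll; rewrite E (negPf tv) eqxx; split=> //.
  case: l2 tl vl ul Ll => [|u l2] /= tl vl ul; first by rewrite E eqxx.
  case=> tu Ll; rewrite E eqxx; split=> //.
  have E' w : w \in u :: l2 -> nx' (n + w) = nx (n + w).
    move=> wl; rewrite E eqn_add2l (inj_eq val_inj) [n + w == _]eq_sym.
    rewrite /last_token /= (negPf (tl _ wl)).
    by case: eqP wl => // ->; rewrite (negPf vl).
  apply: links_ext Ll; first by rewrite E' ?mem_head.
  by move=> w wl; rewrite E' // inE wl orbT.
rewrite inE negb_or => /andP[vu vl] /andP[ul1 ul] [tu Ll]; split.
  rewrite E (negPf tv); case: eqP => // te; move: (last_tokenP (n + u) l1).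
  rewrite -(last_token_cons t) -te => -[tw|[w wl tw]];
    first by have := tl u (mem_head _ _); rewrite -tw eqxx.
  have := tl w; rewrite inE mem_cat wl orbT => /(_ isT).
  by rewrite -tw eqxx.
apply: IH => //; first by move=> w wl; rewrite eqn_add2l (inj_eq val_inj);
  apply: contraNneq ul1 => ->.
by rewrite eqn_add2l (inj_eq val_inj) eq_sym.
Qed.

End TokenLists.

Lemma openingE n x : (x + 1 - n == 0) = (x < n).
Proof. lia. Qed.

Section Reading.

Variables (n : nat) (f : 'I_n -> 'I_n).
Let K := max_component_size f.

(** The invariant speaks of the binary values of the prefixes read so far.
Appending bits [a] and [b] to values [x < y] keeps the order, since
[2 * x + a < 2 * y + b]. *)
Lemma runs_compare s wl wr el er T :
    loaded f s -> word s COUNT 0 = size wl -> size wl <= bound n ->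
    size wr = size wl -> 3 * size wl < T ->
    reads n (word s NEXT) (word s LEFT 0) wl el ->
    reads n (word s NEXT) (word s RIGHT 0) wr er ->
  runs n compare s T (fun s' => bit s' LESS 0 =
    (binary_value wl < binary_value wr)).
Proof.
move=> ld szC szB szr le_T rl rr; have [z0 o0 _] := ld.
apply: runs_seq0; apply: runs_putbit => //=.
apply: runs_seq0; apply: runs_putbit => //=.
pose I k s' := [/\ reads n (word s NEXT) (word s' LEFT 0) (drop k wl) el,
  reads n (word s NEXT) (word s' RIGHT 0) (drop k wr) er,
  bit s' DIFFER 0 = (binary_value (take k wl) != binary_value (take k wr))
  & bit s' LESS 0 = (binary_value (take k wl) < binary_value (take k wr))].
apply: (@runs_for _ _ _ _ _ (size wl) 2 _ I) => //.
- by rewrite mulnC.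
- by move=> s' u /=; rewrite u.1.
- by split; rewrite ?drop0 ?take0.
- move=> k s' kN u _ [Rl Rr Dk Lk].
  have [bl Rl'] := reads_drop kN Rl.
  have kr : k < size wr by rewrite szr.
  have [br Rr'] := reads_drop kr Rr.
  have [z o _] : loaded f s' by apply: loaded_unchanged u _ ld.
  pose Q s1 := bit s1 DIFFER 0 = (binary_value (take k.+1 wl) != binary_value
    (take k.+1 wr)) /\
    bit s1 LESS 0 = (binary_value (take k.+1 wl) < binary_value (take k.+1 wr)).
  apply: (@runs_seq _ _ _ _ 2 0) => //.
  apply: (@runs_weaken _ _ _ 2 _ Q) => //.
    rewrite /Q (take_nth false kN) (take_nth false kr) !binary_value_rcons.
    apply: runs_if => //=; rewrite Dk eqb_id.
    case: ifP => [ne|/negbFE/eqP eq]; last first.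
      apply: runs_if => //=; rewrite !z !o !openingE bl br eq.
      case: ifP => [/eqP-> | ne].
        by apply: runs_skip; rewrite Dk Lk eq !eqxx !ltnn.
      apply: runs_seq0; apply: runs_putbit => //=; apply: runs_putbit => //=.
      rewrite z o openingE br; move: ne.
      by case: (nth false wl k); case: (nth false wr k) => //= _; split; lia.
    by apply: runs_skip; rewrite Dk Lk ne; case: (nth false wl k);
      case: (nth false wr k); split; lia.
  move=> s1 u1 [D1 L1] _; apply: runs_seq0; apply: runs_copy => //=.
  apply: runs_copy => //=.
  have El : word s NEXT (word s' LEFT 0) = word s1 NEXT (word s1 LEFT 0).
    by rewrite !u1.1 // (u.1 NEXT).
  have Er : word s NEXT (word s' RIGHT 0) = word s1 NEXT (word s1 RIGHT 0).
    by rewrite !u1.1 // (u.1 NEXT).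
  by rewrite El in Rl'; rewrite Er in Rr'; split.
- move=> s' _ _ [_ _ _ ->].
  by rewrite take_size -szr take_size.
Qed.

Lemma sum_filter_le (l : seq 'I_n) (P : pred 'I_n) (F : 'I_n -> nat) :
  \sum_(u <- [seq u <- l | P u]) F u <= \sum_(u <- l) F u.
Proof. by rewrite big_filter big_mkcond leq_sum // => u _; case: ifP. Qed.

Lemma size_tree_label_sum (v : 'I_n) :
  size (tree_label f v) = 2 + \sum_(u <- children f v) size (tree_label f u).
Proof.
rewrite tree_label_children /= size_cat size_flatten /shape -map_comp sumnE
  big_map /=.
by rewrite (perm_big _ (perm_sorted_children f v)) addn1.
Qed.

(** [ch v] is the current list of children of [v], made of those that are
[done].  A vertex counts with two bits in [SIZE], and its inserted children with
their complete labels. *)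
Definition child_lists (done : pred 'I_n) (ch : 'I_n ->
  seq 'I_n) (s : store) : Prop :=
  [/\ forall v, perm_eq (ch v) [seq u <- children f v | done u],
      forall v, sorted (label_ge f) (ch v),
      forall v : 'I_n, links (word s NEXT) v (ch v) (n + v),
      forall v : 'I_n, word s SIZE v =
        2 + \sum_(u <- ch v) size (tree_label f u)
    & forall v : 'I_n, on_cycle f v -> word s NEXT (n + v) = f v].

Lemma reads_children nx t l e :
    links nx t l e ->
    {in l, forall u : 'I_n, reads n nx u (tree_label f u) (nx (n + u))} ->
  reads n nx (nx t) (flatten [seq tree_label f u | u <- l]) e.
Proof.
elim: l t => //= u l IH t [-> Ll] R; apply: reads_cat; first by apply: R;
  rewrite mem_head.
by apply: IH => // w wl; apply: R; rewrite inE wl orbT.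
Qed.

Lemma children_done (done : pred 'I_n) ch s (v : 'I_n) :
    child_lists done ch s -> (forall u, depth f v < depth f u -> done u) ->
  perm_eq (ch v) (children f v).
Proof.
case=> perm_ch _ _ _ _ dn; rewrite (permPl (perm_ch v)).
rewrite (@eq_in_filter _ _ predT) ?filter_predT // => u uv.
by rewrite dn // (depth_child uv).
Qed.

(** When everything deeper than [v] has been inserted, the links spell the
label of [v], and reading it ends at the closing token of [v]. *)
Lemma reads_tree (done : pred 'I_n) ch s (v : 'I_n) :
    child_lists done ch s -> (forall u, depth f v < depth f u -> done u) ->
  reads n (word s NEXT) v (tree_label f v) (word s NEXT (n + v)).
Proof.
move=> CL; elim/(@tree_ind _ f): v => v IH dn; have [_ sor lin _ _] := CL.
have perm_v := children_done CL dn.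
rewrite (tree_label_sorted perm_v (sor v)) /=; split; first exact: ltn_ord.
apply: (@reads_cat _ _ _ _ (n + v)); last by split=> //=; lia.
apply: reads_children (lin v) _ => u; rewrite (perm_mem perm_v) => uv.
apply: IH => // w; rewrite (depth_child uv) => dw; apply: dn; exact: ltnW.
Qed.

Lemma size_done (done : pred 'I_n) ch s (v : 'I_n) :
    child_lists done ch s -> (forall u, depth f v < depth f u -> done u) ->
  word s SIZE v = size (tree_label f v).
Proof.
move=> CL dn; have [_ _ _ -> _] := CL.
by rewrite size_tree_label_sum (perm_big _ (children_done CL dn)).
Qed.

End Reading.

(** * Inserting a vertex into the list of its parent *)

Section Insert.

Variables (n : nat) (f : 'I_n -> 'I_n).
Let K := max_component_size f.

Lemma size_label_lt u v : size (tree_label f u) < size (tree_label f v) ->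
  binary_value (tree_label f u) < binary_value (tree_label f v).
Proof.
by rewrite !tree_labelE => lt; apply: binary_value_true_size; apply: lt.
Qed.

Lemma tree_label_bound v : size (tree_label f v) <= bound n.
Proof.
apply: leq_trans (tree_label_le f v) _.
by rewrite /bound; have := max_card (component f v); rewrite card_ord; lia.
Qed.

Lemma tree_label_le_max v : size (tree_label f v) <= 2 * K.
Proof.
by apply: leq_trans (tree_label_le f v) _; rewrite leq_mul2l component_card_le.
Qed.

Section Search.

Variables (s : store) (done : pred 'I_n) (ch : 'I_n -> seq 'I_n) (v : 'I_n).
Hypotheses (ld : loaded f s) (Vs : word s VERTEX 0 = v).
Hypotheses (CL : child_lists f done ch s) (ncv : ~~ on_cycle f v) (ndv : ~~
  done v).
Hypothesis dn : forall u, depth f v < depth f u -> done u.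

(** The loop stops precisely when the label of the sibling [u] has a smaller
value than that of [v], whether lengths or bits decide. *)
Lemma runs_search_step s1 (u : 'I_n) :
    unchanged ((true, PARENT) :: writes search_step) s s1 ->
      bit s1 STOP 0 = false ->
    word s1 NEXT (word s1 PREV 0) = nat_of_ord u -> depth f u = depth f v ->
  runs n search_step s1 (3 * size (tree_label f u) + 6) (fun s' =>
    [/\ word s' SIBLING 0 = u,
        bit s' STOP 0 = (binary_value (tree_label f u) < binary_value
          (tree_label f v))
      & word s' PREV 0 = if bit s' STOP 0 then word s1 PREV 0 else n + u]).
Proof.
move=> us S1 U duv.
have V1 : word s1 VERTEX 0 = v by rewrite us.1.
have sz1 w : depth f w = depth f v -> word s1 SIZE w = size (tree_label f w).
  by move=> dw; rewrite us.1 // (size_done CL) // => x; rewrite dw; apply: dn.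
have [z o _] : loaded f s1 by apply: loaded_unchanged us _ ld.
have ld1 : loaded f (set_word s1 SIBLING 0 (word s1 NEXT (word s1 PREV 0))).
  exact: loaded_unchanged us _ ld.
apply: runs_seq0; apply: runs_copy => //=.
rewrite U in ld1 *.
apply: runs_if => //; first by rewrite addnS.
rewrite /= z o openingE ltn_ord eqxx.
apply: (@runs_seq _ _ _ _ (3 * size (tree_label f u) + 3) 2); first by lia.
apply: (@runs_weaken _ _ _ (3 * size (tree_label f u) + 3) _ (fun s' =>
  bit s' STOP 0 = (binary_value (tree_label f u) < binary_value (tree_label f
    v)))) => //.
  apply: runs_if => //; first by rewrite addnS.
  rewrite /= z V1 !sz1 // subn_eq0 eqb_id;
    case: (leqP (size (tree_label f v)) (size (tree_label f u))) =>
      [le_vu|lt_uv]; last first.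
    by rewrite /=; apply: runs_putbit => //=; rewrite size_label_lt.
  apply: runs_if => //=; first by lia.
  rewrite z V1 !sz1 // subn_eq0 eqb_id;
    case: (leqP (size (tree_label f u)) (size (tree_label f v))) =>
      [le_uv|lt_vu]; last first.
    by rewrite /=; apply: runs_skip; rewrite /= S1 ltnNge ltnW // size_label_lt.
  rewrite /=; have szuv : size (tree_label f v) =
    size (tree_label f u) by apply/eqP; rewrite eqn_leq le_vu le_uv.
  apply: runs_seq0; apply: runs_copy => //=.
  apply: runs_seq0; apply: runs_copy => //=.
  apply: runs_seq0; apply: runs_copy => //=.
  rewrite V1 sz1 //; set s3 := set_word _ _ _ _.
  apply: (@runs_seq _ _ _ _ (3 * size (tree_label f u) + 1) 0); first by lia.
  have rd w : depth f w = depth f v ->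
      reads n (word s3 NEXT) w (tree_label f w) (word s NEXT (n + w)).
    move=> dw; apply: (@reads_ext _ (word s NEXT)) => [x|];
      first by rewrite /= us.1.
    by apply: (reads_tree CL) => x; rewrite dw; apply: dn.
  apply: (runs_weaken (runs_compare (f := f) (s := s3) (T :=
    3 * size (tree_label f u) + 1)
    ld1 _ _ _ _ (rd u duv) (rd v erefl))) => //.
  - exact: tree_label_bound.
  - by rewrite addn1.
  by move=> s4 u4 L4 _; apply: runs_putbit.
move=> s3 u3 S3 _; apply: runs_if => //=; rewrite S3.
have [o3 p3] : word s3 ORDER 0 = n /\ word s3 PREV 0 = word s1 PREV 0.
  by split; rewrite u3.1.
have U3 : word s3 SIBLING 0 = u by rewrite u3.1.
case: eqP => [e|ne].
  apply: runs_put => //=; first by rewrite o3 U3 /bound; have := ltn_ord u; lia.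
  by rewrite S3 e /= o3 U3.
apply: runs_skip; rewrite S3 U3 p3; split=> //; move: ne; by case: (_ < _).
Qed.

Lemma sorted_insert (l1 l2 : seq 'I_n) :
  sorted (label_ge f) (rcons l1 v) -> path (label_ge f) v l2 ->
  sorted (label_ge f) (l1 ++ v :: l2).
Proof.
rewrite -cat_rcons; case: l1 => //= x l1 s1 p2.
by rewrite cat_path s1 last_rcons.
Qed.

Let p := f v.
Let P := tree_label f.

Lemma sum_inserted_le w : \sum_(u <- ch w) size (P u) <= size (P w).
Proof.
have [perm_ch _ _ _ _] := CL; rewrite (perm_big _ (perm_ch w)) /=.
by apply: leq_trans (sum_filter_le _ _ _) _;
  rewrite /P size_tree_label_sum leq_addl.
Qed.

(** A step at the sibling [u] costs at most a multiple of the length of its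
label, and these lengths add up to at most the length of the label of the
parent.  The constant overhead is absorbed since a label has at least two
bits. *)
Lemma runs_search s1 T :
    unchanged [:: (true, PARENT); (true, PREV); (false, STOP)] s s1 ->
    bit s1 STOP 0 = false -> word s1 PREV 0 = p ->
    7 * size (P p) + 8 <= T ->
  runs n (While (GetBit STOP (Const 0)) (Bit false) search_step) s1 T (fun s' =>
    exists l1 l2, [/\ ch p = l1 ++ l2, word s' PREV 0 = last_token p l1,
      word s' SIBLING 0 = word s NEXT (last_token p l1)
    & sorted (label_ge f) (l1 ++ v :: l2)]).
Proof.
move=> us1 S1 P1 le_T; have [perm_ch sor lin _ _] := CL.
have chp u : u \in ch p -> u \in children f p.
  by rewrite (perm_mem (perm_ch p)) mem_filter => /andP[].
have vp : v \in children f p by rewrite mem_children eqxx.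
have dch u : u \in ch p -> depth f u = depth f v.
  by move/chp => up; rewrite (depth_child up) (depth_child vp).
(* Three tests for each bit that is compared, and fewer than eight others. *)
pose cost l2 := \sum_(u <- l2) (3 * size (P u) + 8) + 8.
pose I t s' := exists l1 l2, [/\ ch p = l1 ++ l2, word s' PREV 0 =
  last_token p l1,
  sorted (label_ge f) (rcons l1 v)
  & if bit s' STOP 0 then [/\ 0 < t, path (label_ge f) v l2
      & word s' SIBLING 0 = word s NEXT (last_token p l1)]
    else cost l2 <= t].
apply: (@runs_while _ _ _ _ _ _ I) => //.
  exists [::], (ch p); split=> //; rewrite S1; apply: leq_trans le_T.
  rewrite leq_add2r (@leq_trans (\sum_(u <- ch p) 7 * size (P u))) //.
    by apply: leq_sum => u _; rewrite /P size_tree_label preorderE /=; lia.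
  by rewrite -big_distrr leq_mul2l /= sum_inserted_le.
move=> t s2 u2 [l1 [l2 [chE P2 sor1 H]]]; rewrite /=.
have us : unchanged ((true, PARENT) :: writes search_step) s s2.
  exact: unchanged_trans (unchanged_all _ us1) (unchanged_all _ u2).
have := lin p; rewrite chE => /links_last NE.
case S2: (bit s2 STOP 0) H => H.
  case: H => t0 path2 sib; split=> //=.
  by exists l1, l2; split=> //; apply: sorted_insert.
have t8 : 8 <= t by apply: leq_trans H; rewrite /cost leq_addl.
split; first by lia.
have [z o _] : loaded f s2 by apply: loaded_unchanged us _ ld.
rewrite eqxx; case: l2 chE H NE => [|u l2] chE H NE.
  exists 1, 1; split; first by lia.
  apply: runs_seq0; apply: runs_copy => //=.
  have U2 : word s2 NEXT (word s2 PREV 0) = n + p by rewrite us.1 // P2.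
  apply: runs_if => //=; rewrite z o openingE U2 ltnNge leq_addr /=.
  apply: runs_putbit => //=; exists l1, [::]; split=> //=.
have uch : u \in ch p by rewrite chE mem_cat mem_head orbT.
have U2 : word s2 NEXT (word s2 PREV 0) = u by rewrite us.1 // P2.
exists (3 * size (P u) + 6), (cost l2); split.
  by apply: leq_trans H; rewrite /cost big_cons; lia.
apply: (runs_weaken (runs_search_step us S2 U2 (dch u uch))) =>
  // s3 u3 [U3 S3 P3].
rewrite /I S3; rewrite S3 in P3.
have sorl : path (label_ge f) u l2.
  by have := sor p; rewrite chE; case: (l1) => //= x l;
    rewrite cat_path => /andP[_ /andP[_]].
case: ltnP P3 => [lt_uv|le_vu] P3.
  exists l1, (u :: l2); split=> //; first by rewrite P3.
  by split=> //=; [rewrite /cost;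
    lia | rewrite /label_ge /bits_ge ltnW | rewrite NE U3].
exists (rcons l1 u), l2; split=> //; first by rewrite cat_rcons.
  by rewrite P3 /last_token map_rcons last_rcons.
have := sor p; rewrite chE -cat_rcons => /cat_sorted2[+ _].
have uv : label_ge f u v := le_vu.
case: (l1) => [|x l] /=; first by rewrite andbT.
by rewrite [in X in _ -> X]rcons_path last_rcons => ->.
Qed.

(** Only the list of the parent changes: its tokens are different from those of
all other lists. *)
Lemma runs_insert T : 14 * K + 8 <= T ->
  runs n insert s T (fun s' => exists ch',
    child_lists f (fun u => done u || (u == v)) ch' s').
Proof.
move=> le_T; have [perm_ch sor lin siz cyc] := CL; have [_ o0 S0] := ld.
have uch w : uniq (ch w) by rewrite (perm_uniq (perm_ch w)) filter_uniq
  ?children_uniq.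
have chw u w : u \in ch w -> [/\ f u = w, ~~ on_cycle f u & done u].
  by rewrite (perm_mem (perm_ch w)) mem_filter mem_children =>
    /and3P[-> /eqP-> ->].
have vch w : v \notin ch w by apply: contra ndv => /chw[].
apply: runs_seq0; apply: runs_copy => //=.
apply: runs_seq0; apply: runs_copy => //=.
apply: runs_seq0; apply: runs_putbit => //=.
rewrite Vs S0; set s1 := set_bit _ _ _ _.
apply: (@runs_seq _ _ _ _ T 0); first by rewrite addn0.
apply: (runs_weaken (runs_search (s1 := s1) _ _ _ (leqnn _))) => //.
- split=> a i; rewrite !inE !xpair_eqE /=; last by case: eqP.
  by do 2![case: eqP => //].
- by apply: leq_trans le_T; have := tree_label_le_max (f v); rewrite /P /p; lia.
move=> s2 u2 [l1 [l2 [chE P2 U2 sor2]]] u12.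
have [V2 Pa2] : word s2 VERTEX 0 = v /\ word s2 PARENT 0 = p by rewrite !u2.1.
have o2 : word s2 ORDER 0 = n by rewrite u2.1.
have N2 x : word s2 NEXT x = word s NEXT x by rewrite u2.1.
have Z2 x : word s2 SIZE x = word s SIZE x by rewrite u2.1.
apply: runs_seq0; apply: runs_copy => //=; apply: runs_seq0;
  apply: runs_copy => //=.
have szv : word s SIZE v = size (P v) by apply: size_done CL _.
pose done' u := done u || (u == v).
have perm_new : perm_eq (l1 ++ v :: l2) [seq u <- children f p | done' u].
  have perm_v : perm_eq (l1 ++ v :: l2) (v :: ch p).
    by rewrite chE -cat1s perm_catCA.
  rewrite (permPl perm_v); apply: uniq_perm => /= [||u].
  - by rewrite vch uch.
  - by rewrite filter_uniq ?children_uniq.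
  rewrite inE (perm_mem (perm_ch p)) (mem_filter done) (mem_filter done')
    /done'.
  by case: eqVneq => [->|_]; rewrite ?orbF //= orbT mem_children eqxx.
have sum_new : \sum_(u <- l1 ++ v :: l2) size (P u) =
  \sum_(u <- ch p) size (P u) + size (P v).
  by rewrite chE !big_cat big_cons /=; lia.
apply: runs_put => //=; rewrite Pa2 V2 !Z2 szv siz -addnA -sum_new.
  apply: leq_trans (tree_label_bound p).
  rewrite -/P /P size_tree_label_sum leq_add2l (perm_big _ perm_new) /=.
  exact: sum_filter_le.
exists (fun w => if w == p then l1 ++ v :: l2 else ch w).
rewrite o2 P2 U2.
(* The token whose link is redirected belongs to no other list. *)
have neq_last x : (forall u, u \in ch p -> x != n + u) -> x != p ->
  x != last_token p l1.
  move=> xch xp; have [->//|[u ul ->]] := last_tokenP p l1.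
  by apply: xch; rewrite chE mem_cat ul.
have ord_neq (x u : 'I_n) : x != n + u :> nat by have := ltn_ord x; lia.
split=> w /=.
- case: eqP => [->//|/eqP wp]; rewrite (permPl (perm_ch w)).
  rewrite (@eq_in_filter _ _ done') // => u uw; rewrite /done'.
  case: eqP uw => [->|_]; last by rewrite orbF.
  by rewrite mem_children => /andP[/eqP vw]; rewrite -vw eqxx in wp.
- by case: ifP.
- case: eqP => [->|/eqP wp].
    apply: (@links_insert _ (word s NEXT)) => [x|u ul||||] //.
    + by rewrite N2.
    + by rewrite -chE.
    + by rewrite -chE.
    by rewrite -chE.
  apply: links_ext (lin w) => [|u uw] /=; rewrite N2.
    by rewrite (negPf (ord_neq _ _)) (negPf (neq_last _ _ _)) // => u _;
      apply: ord_neq.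
  have [fu _ _] := chw u w uw.
  rewrite eqn_add2l (inj_eq val_inj); case: eqP => [uv|_].
    by rewrite -fu uv eqxx in wp.
  rewrite (negPf (neq_last _ _ _)) // => [u' u'p|].
    rewrite eqn_add2l (inj_eq val_inj); apply: contraNneq wp => uu'.
    by have [<- _ _] := chw u' p u'p; rewrite -uu' fu.
  by rewrite eq_sym ord_neq.
- rewrite (inj_eq val_inj); case: eqP => [_ //|_]; by rewrite Z2 siz.
move=> cw; rewrite N2 eqn_add2l (inj_eq val_inj).
case: eqP => [wv|_]; first by move: ncv; rewrite -wv cw.
rewrite (negPf (neq_last _ _ _)) ?cyc // => [u /chw[_ ncu _]|].
  by rewrite eqn_add2l (inj_eq val_inj); apply: contraNneq ncu => <-.
by rewrite eq_sym ord_neq.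
Qed.

End Search.
End Insert.

(** * Setting up the lists *)

Section Setup.

Variables (n : nat) (f : 'I_n -> 'I_n) (cs : seq {set 'I_n}).
Let K := max_component_size f.

Lemma card_below (A : {set 'I_n}) (v : 'I_n) :
  #|[pred u in A | u < v.+1]| = #|[pred u in A | u < v]| + (v \in A).
Proof.
rewrite (cardD1 v) !inE ltnSn andbT addnC; congr (_ + _); apply: eq_card => u.
by rewrite !inE ltnS ltn_neqAle (inj_eq val_inj) andbCA.
Qed.

Lemma card_below_all (A : {set 'I_n}) : #|[pred u in A | u < n]| = #|A|.
Proof. by apply: eq_card => u; rewrite !inE ltn_ord andbT. Qed.

Lemma index_component (csE : cs =i components f) u v :
  (index (component f u) cs == index (component f v) cs) =
  (component f u == component f v).
Proof.
have cin w : component f w \in cs by rewrite csE component_in.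
apply/eqP/eqP => [e|->//].
by rewrite -(nth_index set0 (cin u)) e nth_index.
Qed.

Definition lengths_known (s : store) := forall v,
  word s LENGTH (index (component f v) cs) = 2 * #|component f v|.

Definition best_on_cycle (s : store) := forall v, exists r : 'I_n,
  [/\ on_cycle f r, component f r = component f v
    & word s BEST (index (component f v) cs) = r].

Lemma runs_init_lists s T :
    identified f cs s -> word s MAXDEPTH 0 = 0 ->
      (forall i, word s LENGTH i = 0) ->
    n * 2 < T ->
  runs n init_lists s T (fun s' =>
    [/\ child_lists f pred0 (fun => [::]) s',
        (forall v, depth f v <= word s' MAXDEPTH 0) /\ word s' MAXDEPTH 0 <= K,
        lengths_known s' & best_on_cycle s']).
Proof.
case=> ld ucs csE szcs vert M0 L0 le_T; have [z0 o0 S0] := ld.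
pose I k s' := [/\ (forall v : 'I_n, v < k ->
  [/\ word s' NEXT v = n + v, word s' SIZE v = 2
      & on_cycle f v -> word s' NEXT (n + v) = f v]),
    (forall v : 'I_n, v < k -> depth f v <=
      word s' MAXDEPTH 0) /\ word s' MAXDEPTH 0 <= K,
    (forall v, word s' LENGTH (index (component f v) cs) =
       2 * #|[pred u in component f v | u < k]|)
  & (forall v : 'I_n, v < k -> on_cycle f v -> exists r : 'I_n,
     [/\ on_cycle f r, component f r = component f v
       & word s' BEST (index (component f v) cs) = r])].
apply: (@runs_for _ _ _ _ _ n 1 _ I) => //; first exact: leq_bound.
- by move=> s' u /=; rewrite u.1.
- split=> //= [|v]; first by rewrite M0.
  by rewrite L0 eq_card0 // => u; rewrite !inE andbF.
- move=> k s' kn u Vk [Nk [Dk DK] Lk Bk]; pose v := Ordinal kn.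
  have [z o S] : loaded f s' by apply: loaded_unchanged u _ ld.
  have [cyk dk _ ck] := vert v; rewrite /= in cyk dk ck.
  have [D' C'] : word s' DEPTH k = depth f v /\ word s' COMP k =
    index (component f v) cs.
    by rewrite !u.1.
  have cy' : bit s' CYCLE k = on_cycle f v by rewrite u.2.
  have lt_k (w : 'I_n) : w < k.+1 -> w = v \/ (w < k /\ w != v).
    rewrite ltnS leq_eqVlt => /orP[/eqP wk|wk]; first by left; apply: val_inj.
    by right; split=> //; rewrite -(inj_eq val_inj) /= neq_ltn wk.
  have dK : depth f v < K := depth_lt_max f v.
  have card_n (A : {set 'I_n}) : #|[pred u in A | u < k]| <= n.
    by apply: leq_trans (max_card _) _; rewrite card_ord.
  have cardk := card_below (component f v) v;
    rewrite component_refl /= in cardk.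
  apply: runs_seq0; apply: runs_put => //=; first by rewrite o Vk /bound; lia.
  apply: runs_seq0; apply: runs_put => //=; first by rewrite /bound; lia.
  apply: runs_seq0; apply: runs_put => //=.
    by rewrite Vk D' /bound; have := max_component_le f; rewrite -/K; lia.
  apply: runs_seq0; apply: runs_put => //=.
    by rewrite Vk C' Lk leq_add2r leq_mul2l card_n.
  rewrite Vk C' D' o Lk.
  apply: runs_if => //=; rewrite Vk cy' eqb_id.
  have Lk' w : (if index (component f w) cs == index (component f v) cs
      then 2 * #|[pred u in component f v | u < k]| + 2
      else word s' LENGTH (index (component f w) cs)) =
      2 * #|[pred u in component f w | u < k.+1]|.
    rewrite index_component //; case: eqP => [->|/eqP wv];
      first by rewrite cardk addn1 mulnS addnC.
    by rewrite Lk (card_below _ v) mem_component eq_sym (negPf wv) addn0.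
  have Dk' (w : 'I_n) : w < k.+1 ->
    depth f w <= word s' MAXDEPTH 0 + (depth f v - word s' MAXDEPTH 0).
    by case/lt_k => [->|[/Dk]]; lia.
  have DK' : word s' MAXDEPTH 0 + (depth f v - word s' MAXDEPTH 0) <= K by lia.
  case: ifP => cv.
    apply: runs_seq0; apply: runs_copy => //=; apply: runs_copy => //=.
    rewrite Vk o C' (S v) -/v; split=> [w wk|||w wk cw] //=.
    - have wn := ltn_ord w.
      have -> : (w == n + k :> nat) = false by lia.
      have [->|[wk' wv]] := lt_k w wk; first by rewrite !eqxx.
      have [Nw Zw Cw] := Nk w wk'; rewrite -(inj_eq val_inj) /= in wv.
      rewrite (negPf wv) Nw Zw eqn_add2l (negPf wv); split=> // cw.
      by rewrite Cw //; case: eqP => //; lia.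
    - rewrite index_component //; case: eqP => [wv|wv].
        by exists v; rewrite wv.
      have [wv'|[wk' _]] := lt_k w wk; first by rewrite wv' in wv.
      exact: Bk.
  apply: runs_skip; split=> [w wk|||w wk cw] //=.
  - have wn := ltn_ord w.
    have [->|[wk' wv]] := lt_k w wk; first by rewrite !eqxx cv.
    have [Nw Zw Cw] := Nk w wk'; rewrite -(inj_eq val_inj) /= in wv.
    rewrite (negPf wv) Nw Zw; split=> // cw.
    by rewrite Cw //; case: eqP => //; lia.
  have [wv'|[wk' _]] := lt_k w wk; first by rewrite -wv' cw in cv.
  exact: Bk.
- move=> s' u _ [Nn [Dn DK] Ln Bn]; split.
  + split=> // v; try by have [] := Nn v (ltn_ord v).
    * by rewrite filter_pred0.
    * by have [_ -> _] := Nn v (ltn_ord v); rewrite big_nil.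
  + by split=> // v; apply: Dn.
  + by move=> v; rewrite Ln card_below_all.
  + move=> v; have [r [cr rv Br]] :=
      Bn (tree_root f v) (ltn_ord _) (tree_root_on_cycle f v).
    by exists r; rewrite -(component_root f v).
Qed.
End Setup.

(** * Inserting the vertices by decreasing depth *)

Section Sorting.

Variables (n : nat) (f : 'I_n -> 'I_n).
Let K := max_component_size f.

Lemma child_lists_ext (done done' : pred 'I_n) ch s : done =1 done' ->
  child_lists f done ch s -> child_lists f done' ch s.
Proof. by move=> E [perm_ch ? ? ? ?]; split=> // v; rewrite -(eq_filter E). Qed.

Lemma child_lists_unchanged W s s' done ch :
    unchanged W s s' -> ((true, NEXT) \notin W) && ((true, SIZE) \notin W) ->
  child_lists f done ch s -> child_lists f done ch s'.
Proof.
move=> u /andP[NW ZW] [? ? lin siz cyc]; split=> // v; last 2 first.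
- by rewrite u.1.
- by move=> cv; rewrite u.1 // cyc.
by apply: links_ext (lin v) => [|w _]; rewrite u.1.
Qed.

(** A round tests every vertex, but pays for an insertion only at the vertices
of its level. *)
Lemma runs_level s l ch T :
    loaded f s -> (forall v : 'I_n, word s DEPTH v = depth f v) ->
    word s LEVEL 0 = l -> 0 < l ->
    child_lists f (fun u => l < depth f u) ch s ->
    2 * n + (14 * K + 8) * #|[pred v | depth f v == l]| < T ->
  runs n (For VERTEX (var ORDER)
       (If (null (dist (Get DEPTH (var VERTEX)) (var LEVEL))) (Bit true)
          insert Skip)) s T
    (fun s' => exists ch', child_lists f (fun u => l <= depth f u) ch' s').
Proof.
move=> ld D L l0 CL le_T; have [z0 o0 S0] := ld.
pose C k := if word s DEPTH k == l then 14 * K + 9 else 1.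
pose I k s' := exists ch',
  child_lists f (fun u => (l < depth f u) || (depth f u == l) && (u < k)) ch'
    s'.
apply: (@runs_for_sum _ _ _ _ _ n C _ I) => //; first exact: leq_bound.
- apply: leq_ltn_trans le_T; rewrite big_mkord.
  rewrite (eq_bigr (fun v : 'I_n => 2 + (14 * K + 8) * (depth f v == l)));
    last first.
    by move=> v _; rewrite /C D; case: eqP => _; lia.
  rewrite big_split /= sum_nat_const card_ord mulnC leq_add2l -big_distrr /=.
  by rewrite leq_mul2l -sum1_card [X in _ <=
    X]big_mkcond /= orbC leq_sum // => v _; rewrite inE; case: eqP.
- by move=> s' u /=; rewrite u.1.
- exists ch; apply: child_lists_ext CL => u; by rewrite andbF orbF.
- move=> k s' kn u Vk [ch' CL']; pose v := Ordinal kn.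
  have ld' : loaded f s' by apply: loaded_unchanged u _ ld.
  have [z o S] := ld'.
  have D' : word s' DEPTH k = depth f v by rewrite u.1 // -D.
  have L' : word s' LEVEL 0 = l by rewrite u.1.
  rewrite /C (D v); apply: runs_if => //=; first by case: ifP; lia.
  rewrite z Vk D' L' dist_eq0 eqb_id; case: ifP => dv; last first.
    apply: runs_skip; exists ch'; apply: child_lists_ext CL' => w.
    rewrite ltnS (leq_eqVlt w) -[w == k :> nat]/(w == v).
    by case: (eqVneq w v) => // ->; rewrite dv.
  have ncv : ~~ on_cycle f v by rewrite -depth_eq0 (eqP dv) -lt0n.
  have ndv : ~~ ((l < depth f v) || (depth f v == l) && (v < k)).
    by rewrite (eqP dv) ltnn eqxx ltnn.
  apply: (runs_weaken (runs_insert (v :=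
    v) ld' Vk CL' ncv ndv _ (leqnn _))) => //.
  + by move=> w; rewrite (eqP dv) => ->.
  + by rewrite -/K dv; lia.
  move=> s1 u1 [ch1 CL1]; exists ch1; apply: child_lists_ext CL1 => w.
  rewrite ltnS (leq_eqVlt w) -[w == k :> nat]/(w == v) -orbA; congr (_ || _).
  by case: (eqVneq w v) => [->|_]; rewrite ?dv ?orbT ?orbF.
- move=> s' _ _ [ch' CL']; exists ch'; apply: child_lists_ext CL' => v.
  by rewrite ltn_ord andbT orbC eq_sym -leq_eqVlt.
Qed.

(** Every vertex belongs to at most one level, so all the rounds together pay
for at most [n] insertions. *)
Lemma sum_levels D : \sum_(0 <= j < D) #|[pred v | depth f v == D - j]| <= n.
Proof.
have one d : \sum_(0 <= j < D) (d == D - j) <= 1.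
  (* Summing backwards turns D - j into j.+1. *)
  rewrite big_nat_rev /= (eq_big_nat _ _ (F2 :=
    fun j => nat_of_bool (d == j.+1))); last first.
    by move=> j /andP[_ jD]; congr (nat_of_bool (_ == _)); lia.
  suff -> : \sum_(0 <= j < D) (d == j.+1) = (0 < d <= D) by case: (_ && _).
  elim: D => [|D IH]; first by rewrite big_geq //; case: d.
  by rewrite big_nat_recr //= IH; case: (d); lia.
rewrite (eq_bigr (fun j => \sum_v (depth f v == D - j))); last first.
  by move=> j _; rewrite -sum1_card big_mkcond; apply: eq_bigr => v _;
    rewrite inE; case: eqP.
rewrite exchange_big /= (@leq_trans (\sum_(v < n) 1)) ?leq_sum //.
by rewrite sum1_card card_ord.
Qed.

Lemma runs_sort_children s ch T :
    loaded f s -> (forall v : 'I_n, word s DEPTH v = depth f v) ->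
    (forall v, depth f v <= word s MAXDEPTH 0) -> word s MAXDEPTH 0 <= K ->
    child_lists f pred0 ch s -> K * (2 * n + 2) + (14 * K + 8) * n < T ->
  runs n sort_children s T
    (fun s' => exists ch', child_lists f (fun u => 0 < depth f u) ch' s').
Proof.
move=> ld D DM MK CL le_T; have [z0 o0 S0] := ld;
  set M := word s MAXDEPTH 0 in DM MK.
pose C j := 2 * n + (14 * K + 8) * #|[pred v | depth f v == M - j]| + 1.
pose I k s' := exists ch', child_lists f (fun u => M - k < depth f u) ch' s'.
apply: (@runs_for_sum _ _ _ _ _ M C _ I) => //.
- by apply: leq_trans (leq_bound n); apply: leq_trans MK (max_component_le f).
- apply: leq_ltn_trans le_T.
  rewrite (eq_bigr (fun j => (2 * n + 2) +
      (14 * K + 8) * #|[pred v | depth f v == M - j]|)); last first.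
    by move=> j _; rewrite /C; lia.
  rewrite big_split /= sum_nat_const_nat subn0 -big_distrr /=.
  by apply: leq_add; rewrite ?leq_mul2r ?MK ?orbT // leq_mul2l sum_levels orbT.
- by move=> s' u /=; rewrite u.1.
- by exists ch; apply: child_lists_ext CL => v; rewrite subn0 ltnNge DM.
- move=> k s' kM u Rk [ch' CL'].
  have ld' : loaded f s' by apply: loaded_unchanged u _ ld.
  have M' : word s' MAXDEPTH 0 = M by rewrite u.1.
  have MB : M - k <= bound n.
    apply: leq_trans (leq_bound n); apply: leq_trans (leq_subr _ _) _.
    by apply: leq_trans MK (max_component_le f).
  apply: runs_seq0; apply: runs_put => //=; rewrite Rk M' //.
  apply: (runs_weaken (runs_level (ch := ch') (l := M - k) (T :=
    C k) _ _ _ _ _ _)) => //.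
  + by move=> v /=; rewrite u.1.
  + by rewrite subn_gt0.
  + by rewrite /C addn1.
  move=> s1 u1 [ch1 CL1]; exists ch1; apply: child_lists_ext CL1 => w.
  by rewrite -subnSK.
- by move=> s' _ _ [ch' CL']; exists ch'; apply: child_lists_ext CL' => v;
  rewrite subnn.
Qed.

End Sorting.

(** * Maximal rotations and output of the labels *)

Section Labels.

Variables (n : nat) (f : 'I_n -> 'I_n) (cs : seq {set 'I_n}).
Let K := max_component_size f.

(** Reading a component from the cycle vertex [r] leads through the trees in
the order of the cycle and back to [r]. *)
Lemma reads_cycle ch s r :
    child_lists f (fun u => 0 < depth f u) ch s -> on_cycle f r ->
  reads n (word s NEXT) r (cycle_word f r) r.
Proof.
move=> CL cr; have [_ _ _ _ cyc] := CL.
have R k u : on_cycle f u -> reads n (word s NEXT) u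
    (flatten [seq tree_label f v | v <- traject f u k]) (iter k f u).
  elim: k u => //= k IH u cu; rewrite -iterS iterSr.
  apply: (@reads_cat _ _ _ _ (f u)); last exact: IH (on_cycle_next cu).
  rewrite -(cyc u cu); apply: (reads_tree CL) => w; exact: leq_ltn_trans.
have := R (order f r) r cr; move: (cr); rewrite on_cycle_order => /eqP->.
exact.
Qed.

Definition best_is_largest (s : store) := forall v, exists r : 'I_n,
  [/\ on_cycle f r, component f r = component f v,
      word s BEST (index (component f v) cs) = r
    & component_label f (component f v) = cycle_word f r].

Lemma runs_best_rotations s ch T :
    identified f cs s -> child_lists f (fun u => 0 < depth f u) ch s ->
    lengths_known f cs s -> best_on_cycle f cs s -> n * (6 * K + 5) < T ->
  runs n best_rotations s T best_is_largest.
Proof.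
case=> ld ucs csE szcs vert CL Ls Bs le_T; have [z0 o0 S0] := ld.
pose I k s' := forall v, exists r : 'I_n,
  [/\ on_cycle f r, component f r = component f v,
      word s' BEST (index (component f v) cs) = r
    & forall w : 'I_n, w < k -> on_cycle f w -> component f w = component f v ->
        bits_ge (cycle_word f r) (cycle_word f w)].
apply: (@runs_for _ _ _ _ _ n (6 * K + 4) _ I) => //; first exact: leq_bound.
- by rewrite -addnS.
- by move=> s' u /=; rewrite u.1.
- by move=> v; have [r [cr rv Br]] := Bs v; exists r.
- move=> k s' kn u Vk Bk; pose v := Ordinal kn.
  have ld' : loaded f s' by apply: loaded_unchanged u _ ld.
  have [cyk _ _ ck] := vert v; rewrite /= in cyk ck.
  have C' : word s' COMP k = index (component f v) cs by rewrite u.1.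
  have cy' : bit s' CYCLE k = on_cycle f v by rewrite u.2.
  have lt_k (w : 'I_n) : w < k.+1 -> w = v \/ w < k.
    by rewrite ltnS leq_eqVlt => /orP[/eqP wk|wk]; [left;
      apply: val_inj | right].
  apply: runs_if => //=; first by rewrite addnS.
  rewrite Vk cy' eqb_id; case: ifP => cv; last first.
    apply: runs_skip => w; have [r [cr rw Br r_max]] := Bk w; exists r;
      split=> //.
    by move=> x /lt_k[->|/r_max//]; rewrite cv.
  have [r [cr rv Br r_max]] := Bk v.
  have L' : word s' LENGTH (index (component f v) cs) = 2 * #|component f v|.
    by rewrite u.1 // Ls.
  apply: runs_seq0; apply: runs_copy => //=.
  apply: runs_seq0; apply: runs_copy => //=.
  apply: runs_seq0; apply: runs_copy => //=.
  rewrite Vk C' Br L'; set s1 := set_word _ _ _ _.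
  have rd w : on_cycle f w -> reads n (word s1 NEXT) w (cycle_word f w) w.
    by move=> cw; apply: reads_ext (reads_cycle CL cw) => x; rewrite /= u.1.
  have szr : size (cycle_word f r) = 2 * #|component f v|.
    by rewrite size_cycle_word_component // rv.
  have cK : #|component f v| <= K := component_card_le f v.
  apply: (@runs_seq _ _ _ _ (6 * K + 1) 1); first by lia.
  apply: (runs_weaken (runs_compare (f := f) (s := s1) (T := 6 * K + 1)
    ld' _ _ _ _ (rd r cr) (rd v cv))) => //.
  + by rewrite szr /bound; have := max_card (component f v); rewrite card_ord;
    lia.
  + by rewrite szr size_cycle_word_component.
  + by rewrite szr; lia.
  move=> s2 u2 L2 _; apply: runs_if => //=; rewrite L2 eqb_id.
  have [V2 C2] : word s2 VERTEX 0 = k /\ word s2 COMP k =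
    index (component f v) cs.
    by rewrite !u2.1.
  have B2 x : word s2 BEST x = word s' BEST x by rewrite u2.1.
  case: ltnP => [lt_rv|le_vr].
    apply: runs_copy => //= w /=; rewrite V2 C2.
    have [wv|wv] := eqVneq (component f w) (component f v).
      exists v; rewrite index_component // wv eqxx;
        split=> // x /lt_k[-> _ _|xk cx xw]; first exact: leqnn.
      apply: bits_ge_trans (r_max x xk cx _); last by rewrite xw.
      exact: ltnW.
    have [q [cq qw Bq q_max]] := Bk w; exists q.
    rewrite index_component // (negPf wv) B2; split=> // x /lt_k[->|/q_max//].
    by move=> _ vw; rewrite vw eqxx in wv.
  apply: runs_skip => w.
  have [q [cq qw Bq q_max]] := Bk w; exists q; rewrite /= B2;
    split=> // x /lt_k[->|/q_max//] _ vw.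
  suff -> : q = r by [].
  by apply: val_inj; rewrite /= -Bq -Br vw.
- move=> s' _ _ Bn v; have [r [cr rv Br r_max]] := Bn v; exists r; split=> //.
  rewrite -rv component_label_unique // => w cw wr; apply: r_max => //.
  by rewrite wr.
Qed.

Lemma runs_write_label s c a w e T :
    loaded f s -> word s INDEX 0 = c -> word s LENGTH c = size w ->
    word s POSITION 0 = a -> a + size w <= bound n ->
    reads n (word s NEXT) (word s LEFT 0) w e -> size w < T ->
  runs n (For STEP (Get LENGTH (var INDEX))
       (PutBit LABEL (var POSITION) (opening (var LEFT)) ;;
        set LEFT (Get NEXT (var LEFT)) ;;
        incr POSITION (Const 0) (Const 1))) s T (fun s' =>
    [/\ word s' POSITION 0 = a + size w,
        forall j, j < a -> bit s' LABEL j = bit s LABEL j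
      & [seq bit s' LABEL j | j <- iota a (size w)] = w]).
Proof.
move=> ld Ic Lc Pa aB rd le_T; have [z0 o0 _] := ld.
pose I i s' := [/\ word s' POSITION 0 = a + i,
  reads n (word s NEXT) (word s' LEFT 0) (drop i w) e,
  forall j, j < a -> bit s' LABEL j = bit s LABEL j
  & forall j, j < i -> bit s' LABEL (a + j) = nth false w j].
apply: (@runs_for _ _ _ _ _ (size w) 0 _ I) => //.
- exact: leq_trans (leq_addl _ _) aB.
- by rewrite muln1.
- by move=> s' u /=; rewrite !u.1 // Ic.
- by split; rewrite ?addn0 ?drop0.
- move=> k s' kw u _ [Pk Rk old new].
  have [z o _] : loaded f s' by apply: loaded_unchanged u _ ld.
  have [bk Rk'] := reads_drop kw Rk.
  apply: runs_seq0; apply: runs_putbit => //=.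
  apply: runs_seq0; apply: runs_copy => //=.
  apply: runs_put => //=; rewrite Pk.
    by apply: leq_trans aB; lia.
  split=> [|||j] /=.
  + by rewrite ?Pk; lia.
  + by rewrite u.1.
  + by move=> j ja; rewrite ltn_eqF 1?old //; lia.
  rewrite eqn_add2l ltnS leq_eqVlt; case: eqP => [-> _|_ /new//].
  by rewrite z o openingE bk.
- move=> s' _ _ [Pw _ old new]; split=> //.
  apply: (@eq_from_nth _ false); first by rewrite size_map size_iota.
  move=> j; rewrite size_map size_iota => jw.
  by rewrite (nth_map 0) ?size_iota // nth_iota // new.
Qed.

Lemma runs_write_labels s ch T :
    identified f cs s -> child_lists f (fun u => 0 < depth f u) ch s ->
    lengths_known f cs s -> best_is_largest s -> word s POSITION 0 = 0 ->
    n * (2 * K + 2) < T ->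
  runs n write_labels s T (labels_built f (fun A => index A cs)).
Proof.
case=> ld ucs csE szcs vert CL Ls Bs P0 le_T; have [z0 o0 S0] := ld.
have perm_cs := perm_component_list ucs csE.
have sum_cs : \sum_(A <- cs) size (component_label f A) = 2 * n.
  by rewrite (perm_big _ perm_cs) /= big_enum /= sum_component_labels.
have size_cs : size cs <= n := size_component_list_le ucs csE.
pose pos k := \sum_(A <- take k cs) size (component_label f A).
pose I k s' := word s' POSITION 0 = pos k /\ forall j, j < k ->
  word s' START j + word s LENGTH j <= pos k /\
  [seq bit s' LABEL i | i <- iota (word s' START j) (word s LENGTH j)]
  = component_label f (nth set0 cs j).
have Lj j : j < size cs -> word s LENGTH j =
  size (component_label f (nth set0 cs j)).
  move=> jc; have := mem_nth set0 jc; rewrite csE => cj.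
  rewrite size_component_label //; case/componentsP: (cj) => v jv.
  by rewrite jv -Ls -jv index_uniq.
apply: (@runs_for _ _ _ _ _ (size cs) (2 * K + 1) _ I) => //.
- exact: leq_trans size_cs (leq_bound n).
- by apply: leq_ltn_trans le_T; rewrite -addnS leq_mul2r size_cs orbT.
- by move=> s' u /=; rewrite u.1.
- by split=> //=; rewrite P0 /pos take0 big_nil.
- move=> k s' kc u Ik [Pk done].
  have ld' : loaded f s' by apply: loaded_unchanged u _ ld.
  have := mem_nth set0 kc; rewrite csE => /componentsP[v kv].
  have [r [cr rv Br lr]] := Bs v.
  have kE : index (component f v) cs = k by rewrite -kv index_uniq.
  have posS : pos k.+1 = pos k + size (cycle_word f r).
    by rewrite /pos (take_nth set0 kc) -cats1 big_cat big_seq1 /= kv lr.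
  have posn j : pos j <= 2 * n.
    by rewrite /pos -sum_cs -[in X in _ <=
      X](cat_take_drop j cs) big_cat /= leq_addr.
  apply: runs_seq0; apply: runs_copy => //=.
  apply: runs_seq0; apply: runs_copy => //=; rewrite Ik Pk.
  have B' : word s' BEST k = r by rewrite u.1 // -kE.
  rewrite B'; set s1 := set_word _ _ _ _.
  have rd : reads n (word s1 NEXT) r (cycle_word f r) r.
    by apply: reads_ext (reads_cycle CL cr) => x; rewrite /= u.1.
  have Lk : word s' LENGTH k = size (cycle_word f r) by rewrite u.1 // Lj // kv
    lr.
  apply: (runs_weaken (runs_write_label (s := s1) (a := pos k) (T :=
    2 * K + 1) ld' Ik Lk Pk _ rd _)) => //.
  + by rewrite -posS; apply: leq_trans (posn _) _; rewrite /bound; lia.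
  + rewrite size_cycle_word_component // addn1 ltnS leq_mul2l /=.
    exact: component_card_le.
  move=> s2 u2 [P2 old new]; split; first by rewrite /= P2 posS.
  move=> j; rewrite ltnS leq_eqVlt => /orP[/eqP->|jk].
    have S2 : word s2 START k = pos k by rewrite u2.1 //= eqxx.
    by rewrite /= S2 Lj // kv lr posS leqnn.
  have S2 : word s2 START j = word s' START j.
    by rewrite u2.1 //= ltn_eqF.
  have [le_j lab_j] := done j jk; rewrite /= S2 posS; split.
    exact: leq_trans le_j (leq_addr _ _).
  rewrite -[RHS]lab_j; apply/eq_in_map => i; rewrite mem_iota => /andP[_ ij].
  by rewrite old //; apply: leq_trans ij le_j.
- move=> s' u _ [_ done] A; rewrite -csE => Acs.
  have jc : index A cs < size cs by rewrite index_mem.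
  by have [_] := done _ jc; rewrite nth_index // (u.1 LENGTH).
Qed.

Lemma runs_phase2 s T : 0 < n ->
    identified f cs s ->
    (forall a i : nat, a \in [:: MAXDEPTH; LENGTH;
      POSITION] -> word s a i = 0) ->
    50 * (K * n) <= T ->
  runs n phase2 s T (labels_built f (fun A => index A cs)).
Proof.
move=> n0 Id fresh le_T; have [ld ucs csE szcs vert] := Id.
have K0 : 0 < K := max_component_gt0 f n0.
have identified_unchanged W s' : unchanged W s s' ->
    all (fun x => x \notin W) [:: (false, ZERO); (true, ORDER); (true, SUCC);
      (true, NCOMP); (false, CYCLE); (true, DEPTH); (true, ROOT);
        (true, COMP)] ->
    identified f cs s'.
  move=> u /allP W'; split=> // [||v].
  - by apply: loaded_unchanged u _ ld; rewrite !W'.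
  - by rewrite u.1 ?W'.
  - by have [? ? ? ?] := vert v; rewrite u.2 ?W' // !u.1 ?W'.
apply: (@runs_seq _ _ _ _ (3 * n) (47 * (K * n))).
  by apply: leq_trans le_T; nia.
apply: (runs_weaken (runs_init_lists (T := 3 * n) Id _ _ _)) => //.
- by rewrite fresh.
- by move=> i; rewrite fresh.
- by lia.
move=> s1 u1 [CL1 [DM MK] L1 B1] _.
have Id1 := identified_unchanged _ _ u1 isT; have [ld1 _ _ _ vert1] := Id1.
apply: (@runs_seq _ _ _ _ (30 * (K * n)) (17 * (K * n))); first by lia.
apply: (runs_weaken (runs_sort_children (T :=
  30 * (K * n)) ld1 _ DM MK CL1 _)) => //.
- by move=> v; have [] := vert1 v.
- by nia.
move=> s2 u2 [ch CL2] _.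
have u02 := unchanged_trans (unchanged_all (W' := writes phase2) _ u1)
  (unchanged_all (W' := writes phase2) _ u2).
have Id2 := identified_unchanged _ _ (u02 isT isT) isT.
have L2 : lengths_known f cs s2 by move=> v; rewrite u2.1.
have B2 : best_on_cycle f cs s2.
  by move=> v; have [r [cr rv Br]] := B1 v; exists r; rewrite u2.1.
apply: (@runs_seq _ _ _ _ (12 * (K * n)) (5 * (K * n))); first by lia.
apply: (runs_weaken (runs_best_rotations (T :=
  12 * (K * n)) Id2 CL2 L2 B2 _)) => //.
  by nia.
move=> s3 u3 B3 _.
have u03 := unchanged_trans (u02 isT isT) (unchanged_all (W' :=
  writes phase2) _ u3).
have Id3 := identified_unchanged _ _ (u03 isT) isT.
have CL3 := child_lists_unchanged u3 isT CL2.
have L3 : lengths_known f cs s3 by move=> v; rewrite u3.1.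
have P3 : word s3 POSITION 0 = 0 by rewrite u3.1 // u2.1 // u1.1 // fresh.
apply: (runs_weaken (runs_write_labels (T :=
  5 * (K * n)) Id3 CL3 L3 B3 P3 _)) => //.
by nia.
Qed.

End Labels.

(** * Building the trie *)

Definition NODES := 31.
Definition NODE := 32.

Definition descend b :=
  If (GetBit (HASCHILD b) (var NODE)) (Bit false)
    (PutBit (HASCHILD b) (var NODE) (Bit true) ;;
     Put (CHILD b) (var NODE) (var NODES) ;;
     incr NODES (Const 0) (Const 1))
    Skip ;;
  set NODE (Get (CHILD b) (var NODE)).

Definition insert_label :=
  set NODE (Const 0) ;;
  For STEP (Get LENGTH (var INDEX))
    (If (GetBit LABEL (Add (Get START (var INDEX)) (var STEP))) (Bit true)
       (descend true) (descend false)) ;;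
  incr COUNTER (var NODE) (Const 1).

Definition phase3 :=
  set NODES (Const 1) ;; For INDEX (var NCOMP) insert_label.

Lemma eq_HASCHILD b c : (HASCHILD b == HASCHILD c) = (b == c).
Proof. by case: b; case: c. Qed.

Lemma eq_CHILD b c : (CHILD b == CHILD c) = (b == c).
Proof. by case: b; case: c. Qed.

Lemma prefix_rconsE (T : eqType) (x p : seq T) b :
  prefix x (rcons p b) = (x == rcons p b) || prefix x p.
Proof.
apply/prefixP/orP => [[t]|[/eqP->|/prefixP[t ->]]].
- case/lastP: t => [|t c]; first by rewrite cats0 => ->; left.
  by rewrite -rcons_cat => /rcons_inj[-> _]; right; apply: prefix_prefix.
- by exists [::]; rewrite cats0.
- by exists (rcons t b); rewrite rcons_cat.
Qed.

Section Trie.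

Variables (n : nat).

(** [S] lists the nodes in the order of their creation, so a node is numbered
by its position in [S]; [L] lists the strings inserted so far.  The cells beyond
the last node are still blank, as a new node requires. *)
Definition trie_state (S L : seq bits) (s : store) : Prop :=
  [/\ uniq S, index [::] S = 0, word s NODES 0 = size S,
      {in S, forall x, word s COUNTER (index x S) = count_mem x L /\
        forall b, bit s (HASCHILD b) (index x S) = (rcons x b \in S) /\
         (rcons x b \in S -> word s (CHILD b) (index x S) =
           index (rcons x b) S)}
    & forall i, size S <= i ->
        word s COUNTER i = 0 /\ forall b, bit s (HASCHILD b) i = false].

Lemma trie_state_set_word S L s (a : nat) i x :
    a \notin [:: NODES; COUNTER; CHILD true; CHILD false] ->
  trie_state S L s -> trie_state S L (set_word s a i x).
Proof.
rewrite !inE !negb_or => /and4P[aN aC aT aF] [uS S0 szS nodeS freshS].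
have aH b : (CHILD b == a) = false by rewrite eq_sym; apply/negbTE; case: b.
split=> //=; first by rewrite eq_sym (negPf aN).
  by move=> y yS; rewrite eq_sym (negPf aC); have [cy hy] := nodeS y yS;
    split=> // b; rewrite aH.
by move=> j jS; rewrite eq_sym (negPf aC); apply: freshS.
Qed.

(** A new node has no children since [S] is closed under prefixes, and no string
ends there yet. *)
Lemma runs_descend S L p b s T :
    trie_state S L s -> p \in S -> word s NODE 0 = index p S ->
    (forall x c, rcons x c \in S -> x \in S) ->
      count_mem (rcons p b) L = 0 \/ rcons p b \in S ->
    size S < bound n -> 0 < T ->
  runs n (descend b) s T (fun s' => exists S',
    [/\ trie_state S' L s', word s' NODE 0 = index (rcons p b) S'
      & forall x, (x \in S') = (x == rcons p b) || (x \in S)]).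
Proof.
case=> uS S0 szS nodeS freshS pS Np closed newL ltS T0.
pose Q s' := exists S', [/\ trie_state S' L s',
    word s' NODE 0 = index p S' /\ word s' (CHILD b) (index p S') =
      index (rcons p b) S'
    & forall x, (x \in S') = (x == rcons p b) || (x \in S)].
apply: (@runs_seq _ _ _ _ T 0); first by rewrite addn0.
apply: (@runs_weaken _ _ _ T _ Q) => //; last first.
  move=> s1 u1 [S' [[uS' S0' szS' nodeS' freshS'] [N1 C1] memS']] _.
  apply: runs_copy => //=; exists S'; split=> //=; last by rewrite N1 C1.
  exact: trie_state_set_word.
have [cp hp] := nodeS p pS; have [hb cb] := hp b.
apply: runs_if => //=; rewrite Np hb.
case pb: (rcons p b \in S) => /=.
  apply: runs_skip; exists S; split=> //; first by split; rewrite ?cb.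
  by move=> x; case: eqP => [->|].
have ipS : index p S < size S by rewrite index_mem.
apply: runs_seq0; apply: runs_putbit => //=.
apply: runs_seq0; apply: runs_copy => //=.
have CN : (NODES == CHILD b) = false by case: (b).
have CD : (NODE == CHILD b) = false by case: (b).
have CC : (COUNTER == CHILD b) = false by case: (b).
apply: runs_put => //=; rewrite ?CN ?CD /= ?Np szS; first by rewrite addn1.
pose q := rcons p b; exists (rcons S q).
have indexS x : x \in S -> index x (rcons S q) = index x S.
  by move=> xS; rewrite -cats1 index_cat xS.
have indexq : index q (rcons S q) = size S.
  by rewrite -cats1 index_cat pb /= eqxx addn0.
have memS x : (x \in rcons S q) = (x == q) || (x \in S) by rewrite mem_rcons.
have S0in : [::] \in S by rewrite -index_mem S0; case: (S) pS.
split=> //; last first.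
  rewrite indexS // -/q indexq /= CD /=; split=> //.
  by rewrite eqxx (_ : (CHILD b == NODES) = false) ?eqxx //=; case: (b).
split=> //=.
- by rewrite rcons_uniq pb.
- by rewrite indexS.
- by rewrite size_rcons addn1.
- move=> x; rewrite memS => /orP[/eqP->|xS].
    rewrite indexq CC /=; have [C0 H0] := freshS _ (leqnn (size S)); split.
      by rewrite C0; case: newL; rewrite /q ?pb // => ->.
    move=> c; rewrite eq_HASCHILD (gtn_eqF ipS) andbF H0.
    have nq : (rcons q c \in rcons S q) = false.
      rewrite memS; case: eqP => [/(congr1 size)|_] /=;
        first by rewrite size_rcons; lia.
      by apply: contraFF pb => /closed.
    by rewrite nq.
  have [cx hx] := nodeS x xS; rewrite indexS // CC /=; split=> // c.
  have [hc cc] := hx c; rewrite eq_HASCHILD eq_CHILD memS.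
  have -> : (rcons x c == q) = (c == b) && (x == p) by rewrite /q eqseq_rcons
    andbC.
  have -> : (index x S == index p S) = (x == p).
    by apply/eqP/eqP => [e|->//]; rewrite -(nth_index [::] xS) e nth_index.
  have NC : (CHILD c == NODES) = false by case: (c).
  rewrite NC /=; case: andP => [[/eqP-> /eqP->]|_] /=;
    first by rewrite -/q indexq.
  by rewrite hc; split=> // xcS; rewrite cc // indexS.
- move=> i; rewrite size_rcons => iS; have [C0 H0] := freshS i (ltnW iS).
  rewrite CC /=; split=> // c; rewrite eq_HASCHILD (gtn_eqF (ltn_trans ipS iS))
    andbF.
  exact: H0.
Qed.

End Trie.

Section Phase3.

Variables (n : nat) (f : 'I_n -> 'I_n) (cs : seq {set 'I_n}).
Let K := max_component_size f.
Let labels A := component_label f A.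
Hypotheses (ucs : uniq cs) (csE : cs =i components f).

(** While the bit at position [i] is inserted, the nodes are the prefixes of the
strings in [L] and of the first [i] bits of the label.  They are nodes of the
final trie, which bounds their number. *)
Lemma runs_insert_label s S L k T :
    loaded f s -> word s INDEX 0 = k -> k < size cs ->
    labels_built f (fun A => index A cs) s ->
    L = [seq labels A | A <- take k cs] ->
    trie_state S L s -> (forall x, (x \in S) = has (prefix x) ([::] :: L)) ->
    3 * (2 * K) + 1 <= T ->
  runs n insert_label s T (fun s' => exists S',
    trie_state S' (rcons L (labels (nth set0 cs k))) s' /\
    forall x, (x \in S') = has (prefix x) (labels (nth set0 cs k) :: L)).
Proof.
move=> ld Ik kc lab LE TS SE le_T; have [z0 o0 _] := ld.
set A := nth set0 cs k; set w := labels A.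
have Acs : A \in cs by apply: mem_nth.
have Ac : A \in components f by rewrite -csE.
have szw : size w = 2 * #|A| by apply: size_component_label.
have wK : size w <= 2 * K.
  by rewrite szw leq_mul2l /=; case/componentsP: Ac => v ->;
    apply: component_card_le.
have [wn Ln] : size w <= 2 * n /\ size L <= n.
  split; first by rewrite szw leq_mul2l /= -[n in _ <= n]card_ord max_card.
  rewrite LE size_map size_take kc;
    apply: leq_trans (ltnW kc) (size_component_list_le ucs csE).
have labw : [seq bit s LABEL i | i <- iota (word s START k) (word s LENGTH k)]
  = w.
  by have := lab A Ac; rewrite /A index_uniq.
have Lk : word s LENGTH k = size w by rewrite -labw size_map size_iota.
have bitw i : i < size w -> bit s LABEL (word s START k + i) = nth false w i.
  by move=> iw; rewrite -labw (nth_map 0) ?size_iota ?Lk // nth_iota // Lk.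
have sub_nodes (S1 : seq bits) i : uniq S1 ->
    (forall x, (x \in S1) = has (prefix x) (take i w :: L)) ->
      size S1 < bound n.
  move=> uS1 S1E; rewrite /bound; apply: (@leq_ltn_trans (2 * n).+1);
    last by lia.
  apply: leq_trans (trie_size_labels f); apply: uniq_leq_size => // x.
  have incs B : B \in cs -> labels B \in component_labels f.
    by rewrite csE => Bc; apply: map_f; rewrite mem_enum.
  rewrite S1E mem_trie_nodes /= => /orP[xi|/hasP[y]].
    apply/hasP; exists w; first exact: incs.
    by apply: prefix_trans xi (prefix_take _ _).
  rewrite LE => /mapP[B /mem_take Bcs ->] xB; apply/hasP.
  by exists (labels B); first exact: incs.
apply: runs_seq0; apply: runs_put => //=.
pose I i s' := exists S', [/\ trie_state S' L s', word s' NODE 0 =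
  index (take i w) S'
  & forall x, (x \in S') = has (prefix x) (take i w :: L)].
have [_ S0 _ _ _] := TS.
apply: (@runs_seq _ _ _ _ T 0); first by rewrite addn0.
apply: (@runs_for _ _ _ _ _ (size w) 2 _ I) => //=.
- by rewrite /bound; lia.
- by lia.
- by move=> s' u /=; rewrite !u.1 //= Ik.
- by exists S; rewrite take0; split=> //;
  do 2![apply: trie_state_set_word => //].
- move=> i s' iw u It [S' [TS' N' S'E]].
  have [z _ _] : loaded f s' by apply: loaded_unchanged u _ ld.
  have bi : bit s' LABEL (word s' START (word s' INDEX 0) + word s' STEP 0) =
    nth false w i.
    by rewrite It (u.1 INDEX) //= Ik (u.1 START) //= u.2 //= bitw.
  apply: runs_if => //=; rewrite bi eqb_id.
  have [uS' _ _ _ _] := TS'.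
  have step b : nth false w i = b -> runs n (descend b) s' 1
      (fun s'' => I i.+1 (set_word s'' STEP 0 i.+1)).
    move=> bE; apply: (runs_weaken (runs_descend (b := b) (T :=
      1) TS' _ N' _ _ _ _)) => //.
    + by rewrite S'E /= prefix_refl.
    + move=> x c; rewrite !S'E => /hasP[y yL xy]; apply/hasP; exists y => //.
      exact: prefix_trans (prefix_rcons _ _) xy.
    + rewrite S'E /=; case: (boolP (rcons (take i w) b \in L)) =>
      [inL|/count_memPn->]; last by left.
      by right; apply/orP; right; apply/hasP; exists (rcons (take i w) b);
        rewrite ?prefix_refl.
    + exact: sub_nodes uS' S'E.
    move=> s'' u' [S'' [TS'' N'' S''E]]; exists S''.
    rewrite (take_nth false iw) bE; split=> // [|x];
      first exact: trie_state_set_word.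
    by rewrite S''E S'E /= prefix_rconsE orbA.
  by case: ifP => bE; apply: step.
move=> s1 u1 I1 [S1 [TS1 N1 S1E]] _; rewrite take_size in N1 S1E.
have [uS1 S10 sz1 node1 fresh1] := TS1.
have wS1 : w \in S1 by rewrite S1E /= prefix_refl.
have [cw hw] := node1 w wS1.
apply: runs_put => //=; rewrite N1 cw.
  apply: (@leq_trans (size L + 1)); first by rewrite leq_add2r count_size.
  by rewrite /bound; lia.
exists S1; split=> //; split=> //= [x xS|i iS].
  have [cx hx] := node1 x xS; rewrite -cats1 count_cat /= addn0 eq_sym.
  have -> : (index w S1 == index x S1) = (w == x).
    by apply/eqP/eqP => [e|->//]; rewrite -(nth_index [::] wS1) e nth_index.
  split; first by case: eqVneq => [<-|_] //=; rewrite addn0.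
  move=> c; have [hc cc] := hx c; split=> // xc.
  by rewrite -cc //; case: (c).
have [C0 H0] := fresh1 i iS.
by rewrite gtn_eqF // (leq_trans _ iS) // index_mem.
Qed.

Lemma runs_phase3 s T : 0 < n ->
    loaded f s -> word s NCOMP 0 = size cs ->
      labels_built f (fun A => index A cs) s ->
    (forall i, word s COUNTER i = 0) ->
      (forall b i, bit s (HASCHILD b) i = false) ->
    9 * (K * n) <= T ->
  runs n phase3 s T (trie_built (component_labels f)).
Proof.
move=> n0 ld NC lab C0 H0 le_T; have [z0 o0 _] := ld.
have K0 : 0 < K := max_component_gt0 f n0.
pose LL k := [seq labels A | A <- take k cs].
pose I k s' := exists S, trie_state S (LL k) s' /\
  forall x, (x \in S) = has (prefix x) ([::] :: LL k).
apply: runs_seq0; apply: runs_put => //=; first by rewrite /bound; lia.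
apply: (@runs_for _ _ _ _ _ (size cs) (3 * (2 * K) + 1) _ I) => //=.
- exact: leq_trans (size_component_list_le ucs csE) (leq_bound n).
- have := size_component_list_le ucs csE; nia.
- by move=> s' u; rewrite u.1.
- exists [:: [::]]; split; last first.
    by move=> x; rewrite /LL take0 inE /= orbF; case: x.
  rewrite /LL take0; split=> //= x.
  by rewrite inE => /eqP-> /=; rewrite C0; split=> // b; rewrite H0.
- move=> k s' kc u Ik [S [TS SE]].
  have ld' : loaded f s' by apply: loaded_unchanged u _ ld.
  have lab' : labels_built f (fun A => index A cs) s'.
    move=> A Ac; rewrite !u.1 //= -(lab A Ac); apply: eq_map => i.
    by rewrite u.2.
  apply: (runs_weaken (runs_insert_label ld' Ik kc lab' (erefl (LL k)) TS SE
    (leqnn _))) => //.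
  move=> s1 u1 [S1 [TS1 S1E]]; exists S1.
  have LS : LL k.+1 = rcons (LL k) (labels (nth set0 cs k)).
    by rewrite /LL (take_nth set0 kc) map_rcons.
  rewrite LS; split=> [|x]; first exact: trie_state_set_word.
  by rewrite S1E /= has_rcons; case: x => [|c x]; rewrite ?prefix0s.
move=> s' u Ik [S [TS SE]].
have perm_L : perm_eq (LL (size cs)) (component_labels f).
  by rewrite /LL take_size; apply: perm_map (perm_component_list ucs csE).
have SN : S =i trie_nodes (component_labels f).
  move=> x; rewrite SE mem_trie_nodes -(eq_has_r (perm_mem perm_L)) /=.
  case: x => // /=; apply/esym/hasP;
    exists (labels (component f (Ordinal n0))); last exact: prefix0s.
  by apply: map_f; rewrite take_size csE component_in.
have [uS S0 szS node fresh] := TS.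
exists (fun x => index x S); split=> // [x y xN yN e|x xN].
  by rewrite -(nth_index [::] (_ : x \in S)) ?SN // e nth_index ?SN.
have xS : x \in S by rewrite SN.
have [cx hx] := node x xS; split=> [||b].
- have -> : trie_size (component_labels f) = size S.
    by apply/eqP; rewrite /trie_size -(uniq_size_uniq uS SN) trie_nodes_uniq.
  by rewrite index_mem.
- by rewrite cx /trie_counter (permP perm_L).
- by have [hb cb] := hx b; rewrite hb -!SN.
Qed.

End Phase3.

(** * The algorithm as a whole *)

Theorem corollary16 :
  canonical component_label /\
  exists (phase1 phase2 phase3 : cmd) (C : nat),
  forall (n : nat) (f : 'I_n -> 'I_n), 0 < n ->
  (exists M num s1 s2 s3 t1 t2 t3,
    [/\ exec M phase1 (input f) t1 s1,
        exec M phase2 s1 t2 s2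
      & exec M phase3 s2 t3 s3] /\
    [/\ numbering f num,
        components_identified f num s1,
        labels_built f num s2
      & trie_built (component_labels f) s3] /\
    t1 + t2 + t3 <= C * (max_component_size f * n) /\
    memory (Seq phase1 (Seq phase2 phase3)) M <= C * n) /\
  \sum_(A in components f) size (component_label f A) = 2 * n /\
  trie_size (component_labels f) <= C * n.
Proof.
split; first exact: component_label_canonical.
pose cells := size (undup (arrays (Seq phase1 (Seq phase2 phase3)))).
exists phase1, phase2, phase3, (32 * cells + 73) => n f n0; split; last first.
  split; first exact: sum_component_labels.
  apply: leq_trans (trie_size_labels f) _; nia.
have [t1 [s1 [ex1 le1 bs1 [cs Id]]]] := runs_phase1 n0 (bounded_input f).
have [ld1 ucs csE szcs vert] := Id.
have u1 := exec_unchanged ex1.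
have [a i|t2 [s2 [ex2 le2 bs2 lab2]]] := runs_phase2 n0 Id _ (leqnn _) bs1.
  by rewrite !inE => /or3P[]/eqP->; rewrite u1.1.
have u2 := exec_unchanged ex2.
have ld2 : loaded f s2 by apply: loaded_unchanged u2 _ ld1.
have NC2 : word s2 NCOMP 0 = size cs by rewrite u2.1.
have [i|b i|t3 [s3 [ex3 le3 _ trie3]]] :=
    runs_phase3 ucs csE n0 ld2 NC2 lab2 _ _ (leqnn _) bs2.
- by rewrite u2.1 // u1.1.
- by rewrite u2.2 ?u1.2 //; case: b.
exists (capacity n), (fun A => index A cs), s1, s2, s3, t1, t2, t3.
split; first by [].
split; [split=> //|split].
- split=> [A B Ac Bc e|A Ac].
    by rewrite -(nth_index set0 (_ : A \in cs)) ?csE // e nth_index ?csE.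
  by rewrite -(size_component_list ucs csE) index_mem csE.
- split; first by rewrite szcs; apply: size_component_list.
  by move=> v; have [? ? ? ?] := vert v.
(* The phases cost at most 14, 50 and 9 times K * n comparisons. *)
- have : t1 + t2 + t3 <= 73 * (max_component_size f * n) by lia.
  by move/leq_trans; apply; rewrite leq_mul2r leq_addl orbT.
(* The capacity 8 * (2 * n + 2) is at most 32 * n. *)
rewrite /memory -/cells /capacity /bound.
nia.
Qed.
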